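(* Let $F:\mathbb{D}^n\rightarrow\mathbb{R}^{n+1}$ be a smooth minimal immersed $n$-disk with free boundary on the unit sphere $\mathbb{S}^n\subset\mathbb{R}^{n+1}$, that is, $F(\partial\mathbb{D}^n)=F(\mathbb{D}^n)\cap\mathbb{S}^n$ and $\langle\nu^M,\nu^{\mathbb{S}^n}\rangle=0$ along $F(\partial\mathbb{D}^n)$, where $\nu^M$ is a unit normal along $F$ and $\nu^{\mathbb{S}^n}$ the outer unit normal of $\mathbb{S}^n$. Let $M:=F(\mathbb{D}^n)$ and suppose $M$ is not a standard flat disk. Then \[\Big(\sup_{M}|A|^2\Big)^2 > n\inf_{\partial M}|A|^2,\] where $A$ is the second fundamental form of $M$ and $\partial M=F(\partial\mathbb{D}^n)$.
   Context: $|A|^2$ denotes the squared norm of the second fundamental form of the immersion $F$ with respect to the induced metric. *)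

(* Defs.v *)
From HB Require Import structures.
From mathcomp Require Import all_boot all_order all_algebra.
From mathcomp Require Import all_classical all_reals all_analysis.
Set Implicit Arguments. Unset Strict Implicit. Unset Printing Implicit Defensive.
Import Order.TTheory GRing.Theory Num.Theory.
Import numFieldNormedType.Exports.
Local Open Scope classical_set_scope.
Local Open Scope ring_scope.

Section Defs.
Variable R : realType.

Definition dot (m : nat) (u v : 'rV[R]_m) : R := \sum_(k < m) u 0 k * v 0 k.

Definition evec (n : nat) (i : 'I_n) : 'rV[R]_n := delta_mx 0 i.

Definition cball (m : nat) : set 'rV[R]_m := [set x | dot x x <= 1].
Definition usphere (m : nat) : set 'rV[R]_m := [set x | dot x x = 1].

Fixpoint iterD (m p : nat) (vs : seq 'rV[R]_m) (f : 'rV[R]_m -> 'rV[R]_p)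
  : 'rV[R]_m -> 'rV[R]_p :=
  if vs is v :: vs' then 'D_v (iterD vs' f) else f.

Definition smooth (m p : nat) (f : 'rV[R]_m -> 'rV[R]_p) : Prop :=
  forall vs : seq 'rV[R]_m,
    continuous (iterD vs f) /\ forall v x, derivable (iterD vs f) x v.

Variable n : nat.
Implicit Types F : 'rV[R]_n -> 'rV[R]_n.+1.

Definition dF F (i : 'I_n) (x : 'rV[R]_n) : 'rV[R]_n.+1 := 'D_(evec i) F x.
Definition ddF F (i j : 'I_n) (x : 'rV[R]_n) : 'rV[R]_n.+1 :=
  'D_(evec i) ('D_(evec j) F) x.

Definition jacobian F (x : 'rV[R]_n) : 'M[R]_(n, n.+1) :=
  \matrix_(i < n, k < n.+1) dF F i x 0 k.
Definition immersion_on F (D : set 'rV[R]_n) : Prop :=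
  forall x, D x -> row_free (jacobian F x).

Definition metric F (x : 'rV[R]_n) : 'M[R]_n := \matrix_(i, j) dot (dF F i x) (dF F j x).
Definition metric_inv F (x : 'rV[R]_n) : 'M[R]_n := invmx (metric F x).
Definition sff F (nu : 'rV[R]_n -> 'rV[R]_n.+1) (x : 'rV[R]_n) : 'M[R]_n :=
  \matrix_(i, j) dot (ddF F i j x) (nu x).

Definition unit_normal_on F (nu : 'rV[R]_n -> 'rV[R]_n.+1) (D : set 'rV[R]_n) : Prop :=
  {within D, continuous nu} /\
  forall x, D x -> dot (nu x) (nu x) = 1 /\ forall i, dot (nu x) (dF F i x) = 0.

Definition mean_curv F nu (x : 'rV[R]_n) : R :=
  \sum_(i < n) \sum_(j < n) metric_inv F x i j * sff F nu x i j.
Definition normA2 F nu (x : 'rV[R]_n) : R :=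
  \sum_(i < n) \sum_(j < n) \sum_(k < n) \sum_(l < n)
    metric_inv F x i k * metric_inv F x j l * sff F nu x i j * sff F nu x k l.

End Defs.

(* Main.v *)
From Pilot Require Import Defs.
From HB Require Import structures.
From mathcomp Require Import all_boot all_order all_algebra.
From mathcomp Require Import all_classical all_reals all_analysis.
From mathcomp Require Import ring lra.
Import Order.TTheory GRing.Theory Num.Theory.
Import numFieldNormedType.Exports.
Local Open Scope classical_set_scope.
Local Open Scope ring_scope.
Set Implicit Arguments. Unset Strict Implicit. Unset Printing Implicit Defensive.

(** Write s for |A|^2. Simons' identity gives Delta(s/2) >= -s^2 on a minimal
hypersurface, while Delta(|F|^2/2) = n; at a free boundary point the outward
conormal is F itself, the Codazzi equations give d_F(s/2) <= -s, and
d_F(|F|^2/2) = 1. Let S = sup s and c = inf s over the boundary, and suppose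
S^2 <= n c with S > 0. Then s < S on the boundary, since s decreases outwards,
and the maximum principle applied to
  u = s/2 - eps s^2/4 + (al/2) |F|^2
is contradictory for a small eps and for n al slightly above S^2 (1 - eps S):
u is strictly subharmonic, hence it is maximal at a boundary point, where
0 <= d_F u <= al - (1 - eps s) s < 0. The concave term makes the inequality
strict without the Hopf lemma. If S = 0, the normal is constant, and the image
is the whole equatorial disk by a nearest point argument.

All tensors are written in the Euclidean coordinates of R^{n+1}: with
delta_a = sum_j T_aj d_j, T = J^T g^-1, the components of the tangential
gradient, A_ab = delta_a N_b is the second fundamental form extended by zero to
the normal line, and no Christoffel symbol occurs. *)

(** * Directional derivatives *)

(** Comparing [s] with |F|^2 alone gives only weak inequalities: at an interior maximum of s/2 +
    (al/2) |F|^2 one gets n al <= S^2, at a boundary maximum c <= al, and S^2 = n c leaves no room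
    for a contradiction. The factor 1 - eps s opens a gap: the two bounds become n al <= S^2 (1 -
    eps S) and n c (1 - eps s1) <= n al, where s1 < S is the maximum of s on the boundary. The price
    is a term -(eps/2) |grad s|^2; since |grad s|^2 <= 4 s |nabla A|^2, the gradient term of Simons'
    identity absorbs it as long as 3 eps s <= 1. The boundary estimate comes from the support
    function <F, N>: it vanishes along the boundary, and its Hessian there, contracted with A, gives
    d_F s = -2 s - 2 n A(F,F)^2. The map is smooth on the whole space, but minimality is known on
    the closed ball only. A frame around a boundary point reaches beyond the ball, so minimality
    enters there through the trace of A at the point and its one-sided derivatives. That F points
    outwards follows from |F| <= 1, itself a consequence of the maximum principle. *)

Section Lines.
Variables (R : realType) (E : normedModType R).
Implicit Types (f g : E -> R) (a v : E).

Lemma is_derive_line f a v (t : R) : derivable f (a + t *: v) v ->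
  is_derive t 1 (fun s : R => f (a + s *: v)) ('D_v f (a + t *: v)).
Proof.
have H : (fun h : R => h^-1 *: (((fun s => f (a + s *: v)) \o shift t) (h *: (1:R)) - f (a + t *: v)))
  = (fun h : R => h^-1 *: ((f \o shift (a + t *: v)) (h *: v) - f (a + t *: v))).
  by apply/funext => h /=; rewrite [_%:A]mulr1 addrCA scalerDl.
by move=> df; split; rewrite /derivable /derive H.
Qed.

Lemma MVT_line_gt0 f a v (s : R) : 0 < s ->
  (forall t : R, 0 <= t <= s -> derivable f (a + t *: v) v) ->
  exists2 t : R, 0 < t < s & f (a + s *: v) - f a = s * 'D_v f (a + t *: v).
Proof.
move=> s0 df.
have [||t t01 E1] := @MVT R (fun s => f (a + s *: v))
  (fun s => 'D_v f (a + s *: v)) 0 s s0.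
- move=> t /itvP t01; apply: is_derive_line; apply: df.
  by rewrite !t01.
- apply: derivable_within_continuous => t; rewrite in_itv /= => t01.
  by case: (is_derive_line (df _ t01)).
exists t; first by rewrite in_itv in t01.
by move: E1; rewrite scale0r addr0 subr0 mulrC.
Qed.

Lemma derive_seq f a v : derivable f a v ->
  h^-1 * (f (a + h *: v) - f a) @[h --> 0^'] --> 'D_v f a.
Proof.
rewrite /derivable /derive => /cvg_ex [l fl]; rewrite (cvg_lim _ fl) //.
rewrite (_ : (fun h : R => _) = (fun h : R => h^-1 *: ((f \o shift a) (h *: v) - f a))) //.
by apply/funext => h /=; rewrite [a + _]addrC.
Qed.

Lemma is_derive_of_line f a v (d : R) :
  is_derive (0 : R) 1 (fun s : R => f (a + s *: v)) d -> is_derive a v f d.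
Proof.
have H : (fun h : R => h^-1 *: (((fun s => f (a + s *: v)) \o shift 0) (h *: (1:R)) - f (a + 0 *: v)))
  = (fun h : R => h^-1 *: ((f \o shift a) (h *: v) - f a)).
  by apply/funext => h /=; rewrite [_%:A]mulr1 scale0r !addr0 [a + _]addrC.
case=> dl <-; split; last by rewrite /derive H.
by move: dl; rewrite /derivable H.
Qed.

Lemma is_derive_comp f a v (h : R -> R) (df dh : R) :
  is_derive a v f df -> is_derive (f a) 1 h dh ->
  is_derive a v (fun y => h (f y)) (dh * df).
Proof.
move=> [dfa <-] hd; apply: (is_derive_of_line (f := fun y => h (f y))).
have df0 : derivable f (a + (0 : R) *: v) v by rewrite scale0r addr0.
have h1 := is_derive_line df0.
rewrite scale0r addr0 in h1.
have hd0 : is_derive (f (a + (0 : R) *: v)) 1 h dh by rewrite scale0r addr0.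
exact: (@is_derive1_comp R h (fun s => f (a + s *: v)) 0 _ _ hd0 h1).
Qed.

Lemma is_derive_oppdir f a v : derivable f a v -> is_derive a (- v) f (- 'D_v f a).
Proof.
move=> df; apply: is_derive_of_line.
have df0 : derivable f (a + (- 0) *: v) v by rewrite oppr0 scale0r addr0.
have h2 := @is_derive1_comp R (fun s => f (a + s *: v)) (fun s => - s) 0 _ _
  (is_derive_line df0) (is_deriveNid _ _).
rewrite mulrN1 oppr0 scale0r addr0 in h2.
by under eq_fun do rewrite scalerN -scaleNr.
Qed.

(** Only the side t > 0 is compared, so the bound also applies at a point of the unit sphere in a
    direction that enters the ball. *)
Lemma derive_le0 f a v (r : R) : 0 < r -> derivable f a v ->
  (forall t, 0 < t < r -> f (a + t *: v) <= f a) -> 'D_v f a <= 0.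
Proof.
move=> r0 /derive_seq fl H.
have fl' : h^-1 * (f (a + h *: v) - f a) @[h --> 0^'+] --> 'D_v f a.
  exact: cvg_dnbhs_at_right.
rewrite -(cvg_lim _ fl') //; apply: limr_le; first by apply/cvg_ex; exists ('D_v f a).
near=> h; have h0 : 0 < h by near: h; exact: nbhs_right_gt.
rewrite pmulr_rle0 ?invr_gt0 // subr_le0; apply: H; rewrite h0 /=.
by near: h; exact: nbhs_right_lt.
Unshelve. all: by end_near. Qed.

Lemma derive_ge0 f a v (r : R) : 0 < r -> derivable f a v ->
  (forall t, 0 < t < r -> f a <= f (a + t *: v)) -> 0 <= 'D_v f a.
Proof.
move=> r0 df H; rewrite -oppr_le0 -deriveN //.
apply: (derive_le0 r0); first exact: derivableN.
by move=> t /H; rewrite -![(- f) _]/(- (f _)) lerN2.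
Qed.

Lemma near_line (P : set E) a v : nbhs a P ->
  exists2 r : R, 0 < r & forall t, `|t| < r -> P (a + t *: v).
Proof.
move=> aP.
have : \forall t \near (0:R), P (a + t *: v).
  have c : (fun t : R => a + t *: v) @ (0:R) --> a.
    rewrite -[X in _ --> X]addr0 -(scale0r v).
    by apply: cvgD; [exact: cvg_cst | apply: cvgZr_tmp; exact: cvg_id].
  exact: c.
case/nbhs_ballP => r /= r0 H; exists r => // t tr; apply: H.
by rewrite /ball /= sub0r normrN.
Qed.

Lemma derive_max_eq0 f a v : derivable f a v -> (\forall y \near a, f y <= f a) ->
  'D_v f a = 0.
Proof.
move=> dfa fmax; apply/eqP; rewrite eq_le; apply/andP; split.
  have [r r0 H] := near_line v fmax.
  by apply: (derive_le0 r0) => // t /andP[t0 tr]; apply: H; rewrite gtr0_norm.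
have [r r0 H] := near_line (- v) fmax.
have [dN DN] := is_derive_oppdir dfa.
rewrite -oppr_le0 -DN; apply: (derive_le0 r0) => // t /andP[t0 tr].
by apply: H; rewrite gtr0_norm.
Qed.

(** Were the second derivative positive, ['D_v f], which vanishes at the maximum, would be positive
    just after [a] along [v], and the mean value theorem would lift [f] above [f a] there. *)
Lemma derive2_max_le0 f a v : (\forall y \near a, derivable f y v) ->
  derivable ('D_v f) a v -> (\forall y \near a, f y <= f a) ->
  'D_v ('D_v f) a <= 0.
Proof.
move=> df ddf fmax; rewrite leNgt; apply/negP => pos.
have dfa : derivable f a v by move/nbhs_singleton: (df).
have D0 : 'D_v f a = 0 by exact: derive_max_eq0.
have [r r0 H] := near_line v (filterI df fmax).
have [s s0 Hs] : exists2 s : R, 0 < s & forall t, 0 < t < s -> 0 < 'D_v f (a + t *: v).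
  have /derive_seq/cvgrPdist_lt /(_ _ pos) := ddf.
  case/nbhs_ballP => s /= s0 Hs; exists s => // t /andP[t0 ts].
  have := Hs t; rewrite /ball /= sub0r normrN gtr0_norm // => /(_ ts).
  rewrite gt_eqF // => /(_ isT); rewrite D0 subr0.
  move=> /(le_lt_trans (ler_norm _)); rewrite ltrBlDr ltrDl.
  by rewrite pmulr_rgt0 // invr_gt0.
pose m : R := Num.min r s / 2.
have m0 : 0 < m by rewrite divr_gt0 // lt_min r0.
have mr : m < r by rewrite (@lt_le_trans _ _ (Num.min r s)) ?ge_min ?lexx // /m ltr_pdivrMr // ltr_pMr ?lt_min ?r0 // ltr1n.
have ms : m < s by rewrite (@lt_le_trans _ _ (Num.min r s)) ?ge_min ?lexx ?orbT // /m ltr_pdivrMr // ltr_pMr ?lt_min ?r0 // ltr1n.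
have [|t /andP[t0 tm] Et] := @MVT_line_gt0 f a v m m0.
  move=> t /andP[t0 tm]; apply: (H t _).1; rewrite ger0_norm //.
  exact: le_lt_trans mr.
have : f (a + m *: v) - f a <= 0.
  by rewrite subr_le0; apply: (H m _).2; rewrite gtr0_norm.
by rewrite Et pmulr_rle0 // leNgt Hs // t0 (lt_trans tm).
Qed.

Lemma MVT_line f a v (s : R) :
  (forall t : R, `|t| <= `|s| -> derivable f (a + t *: v) v) ->
  exists2 t : R, `|t| <= `|s| & f (a + s *: v) - f a = s * 'D_v f (a + t *: v).
Proof.
move=> df; have [s0|s0|s0] := ltgtP s 0.
- have [||t] := @MVT_line_gt0 f a (- v) (- s); first by rewrite oppr_gt0.
    move=> t /andP[t0 ts]; rewrite scalerN -scaleNr.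
    have /is_derive_oppdir[] // : derivable f (a + (- t) *: v) v.
    by apply: df; rewrite normrN ger0_norm // (le_trans ts) // ler_normr lexx orbT.
  move=> /andP[t0 ts]; rewrite !scalerN !scaleNr opprK -scaleNr => Et.
  have tt : `|- t| <= `|s|.
    by rewrite normrN gtr0_norm // (le_trans (ltW ts)) // ler_normr lexx orbT.
  exists (- t) => //; rewrite Et.
  by have [_ ->] := is_derive_oppdir (df _ tt); rewrite mulrNN.
- have [|t /andP[t0 ts] Et] := @MVT_line_gt0 f a v s s0.
    by move=> t /andP[t0 ts]; apply: df; rewrite ger0_norm // gtr0_norm.
  by exists t => //; rewrite !gtr0_norm // ltW.
- exists 0; first by rewrite normr0.
  by rewrite s0 !scale0r addr0 subrr mul0r.
Qed.
End Lines.

(** * Germs, and differentiation rules for functions in lambda form *)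

Section Near.
Variables (T : topologicalType).

Lemma nearS2 (x : T) (P Q S : set T) : (forall y, P y -> Q y -> S y) ->
  nbhs x P -> nbhs x Q -> nbhs x S.
Proof. by move=> H; exact: filterS2. Qed.

Lemma near_forall (I : finType) (x : T) (P : I -> set T) :
  (forall i, nbhs x (P i)) -> nbhs x [set y | forall i, P i y].
Proof. by move=> H; exact: filter_forall. Qed.

Lemma continuous_near_ext (S : topologicalType) (f g : T -> S) (x : T) :
  (\near x, f x = g x) -> {for x, continuous f} -> {for x, continuous g}.
Proof.
move=> H c A; rewrite -(nbhs_singleton H) => /c cA.
apply: (nearS2 _ H cA) => y e1 Ay.
by rewrite /preimage /= -e1.
Qed.
End Near.

Section Rules.
Variables (R : realType) (E : normedModType R).
Implicit Types (f g : E -> R) (x v : E).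

Lemma is_deriveMf f g x v (df dg : R) : is_derive x v f df -> is_derive x v g dg ->
  is_derive x v (fun y => f y * g y) (df * g x + f x * dg).
Proof.
move=> hf hg; have [d E1] := is_deriveM hf hg.
by split => //; rewrite [LHS]E1 addrC [_ *: df]mulrC.
Qed.

Lemma is_deriveDf f g x v (df dg : R) : is_derive x v f df -> is_derive x v g dg ->
  is_derive x v (fun y => f y + g y) (df + dg).
Proof. by move=> hf hg; exact: is_deriveD hf hg. Qed.

Lemma is_deriveNf f x v (df : R) : is_derive x v f df ->
  is_derive x v (fun y => - f y) (- df).
Proof. by move=> hf; exact: is_deriveN hf. Qed.

Lemma is_deriveBf f g x v (df dg : R) : is_derive x v f df -> is_derive x v g dg ->
  is_derive x v (fun y => f y - g y) (df - dg).
Proof. by move=> hf hg; exact: is_deriveB hf hg. Qed.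

Lemma is_deriveSf (I : Type) (r : seq I) (P : pred I) (h : I -> E -> R) x v (dh : I -> R) :
  (forall i, P i -> is_derive x v (h i) (dh i)) ->
  is_derive x v (fun y => \sum_(i <- r | P i) h i y) (\sum_(i <- r | P i) dh i).
Proof.
move=> H; elim: r => [|i r IH].
  rewrite big_nil (_ : (fun y => _) = cst 0); first exact: is_derive_cst.
  by apply/funext => y; rewrite big_nil.
rewrite big_cons; case: ifP => Pi.
  rewrite (_ : (fun y => _) = (fun y => h i y + \sum_(i <- r | P i) h i y)).
    by apply: is_deriveDf => //; apply: H.
  by apply/funext => y; rewrite big_cons Pi.
rewrite (_ : (fun y => _) = (fun y => \sum_(i <- r | P i) h i y)) //.
by apply/funext => y; rewrite big_cons Pi.
Qed.

Lemma is_deriveVf f x v (df : R) : f x != 0 -> is_derive x v f df ->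
  is_derive x v (fun y => (f y)^-1) (- (df * (f x)^-1 * (f x)^-1)).
Proof.
move=> fx0 [d <-]; split; first exact: derivableV.
rewrite [LHS]deriveV // expr2 invfM scaleNr; congr (- _).
by rewrite [LHS]mulrC mulrA.
Qed.

Lemma is_derive_sqrtf f x v (df : R) : 0 < f x -> is_derive x v f df ->
  is_derive x v (fun y => Num.sqrt (f y)) ((2 * Num.sqrt (f x))^-1 * df).
Proof. by move=> fx0 hf; apply: is_derive_comp hf _; exact: is_derive1_sqrt. Qed.

Lemma is_derive_shiftf f x v c : derivable f (x + c) v ->
  is_derive x v (fun y => f (y + c)) ('D_v f (x + c)).
Proof.
move=> df; have H : (fun h : R => h^-1 *: (((fun y => f (y + c)) \o shift x) (h *: v) - f (x + c)))
  = (fun h : R => h^-1 *: ((f \o shift (x + c)) (h *: v) - f (x + c))).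
  by apply/funext => h /=; rewrite addrA.
by split; rewrite /derivable /derive H.
Qed.

End Rules.

(** * Smooth functions on an open set *)

Section Smooth.
Variables (R : realType) (n : nat).
Local Notation E := 'rV[R]_n.
Implicit Types (f g : E -> R) (U : set E) (x u v : E).

(** All directions are quantified over at each order, so ['D_v] lowers the order by definition. The
    notion is relative to a set because inverse metrics and unit normals are smooth only locally. *)
Fixpoint Ck (k : nat) U f : Prop :=
  (forall x, U x -> {for x, continuous f}) /\
  (if k is k'.+1 then (forall x v, U x -> derivable f x v) /\ forall v, Ck k' U ('D_v f)
   else True).

Definition sm U f := forall k, Ck k U f.

Lemma Ck_cont k U f x : Ck k U f -> U x -> {for x, continuous f}.
Proof. by case: k => [|k] [c _]; exact: c. Qed.

Lemma CkS k U f : Ck k.+1 U f -> Ck k U f.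
Proof.
elim: k f => [|k IH] f [c [d D]]; split => //; split => // v; exact: IH.
Qed.

Lemma Ck_sub k (U W : set E) f : W `<=` U -> Ck k U f -> Ck k W f.
Proof.
move=> WU; elim: k f => [|k IH] f [c H]; split => //; try by move=> x /WU; exact: c.
case: H => d D; split; first by move=> x v /WU; exact: d.
by move=> v; exact: IH (D v).
Qed.

Lemma sm_sub (U W : set E) f : W `<=` U -> sm U f -> sm W f.
Proof. by move=> WU H k; apply: Ck_sub (H k). Qed.

Lemma sm_cont U f x : sm U f -> U x -> {for x, continuous f}.
Proof. by move=> H; apply: Ck_cont (H 0%N). Qed.

Lemma sm_derivable U f x v : sm U f -> U x -> derivable f x v.
Proof. by move=> H Ux; have [_ [+ _]] := H 1%N; exact. Qed.

Lemma sm_is_derive U f x v : sm U f -> U x -> is_derive x v f ('D_v f x).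
Proof. by move=> H Ux; apply: derivableP; apply: sm_derivable Ux. Qed.

Lemma sm_derive U f v : sm U f -> sm U ('D_v f).
Proof. by move=> H k; have [_ [_ ]] := H k.+1; exact. Qed.

Variable U : set E.
Hypothesis oU : open U.

Lemma near_eqU f g x : U x -> (forall y, U y -> f y = g y) -> \near x, f x = g x.
Proof.
move=> Ux H; have : nbhs x U by exact: open_nbhs_nbhs.
by apply: filterS => y /H.
Qed.

Lemma derive_eqU f g x v : U x -> (forall y, U y -> f y = g y) -> 'D_v f x = 'D_v g x.
Proof. by move=> Ux H; apply: near_eq_derive; exact: near_eqU. Qed.

Lemma Ck_ext k f g : (forall y, U y -> f y = g y) -> Ck k U f -> Ck k U g.
Proof.
have cext f' g' : (forall y, U y -> f' y = g' y) -> (forall x, U x -> {for x, continuous f'}) ->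
    forall x, U x -> {for x, continuous g'}.
  by move=> H c x Ux; apply: continuous_near_ext (near_eqU Ux H) (c x Ux).
elim: k f g => [|k IH] f g H [c D]; split => //; try exact: (cext f).
case: D => d D; split.
  by move=> x v Ux; apply: near_eq_derivable (d x v Ux); exact: near_eqU.
move=> v; apply: IH (D v) => y Uy; exact: derive_eqU.
Qed.

Lemma sm_ext f g : (forall y, U y -> f y = g y) -> sm U f -> sm U g.
Proof. by move=> H s k; apply: Ck_ext (s k). Qed.

Lemma sm_cst (c : R) : sm U (fun=> c).
Proof.
move=> k; elim: k c => [|k IH] c; split => //; try by move=> x _; exact: cst_continuous.
split; first by move=> x v _; exact: derivable_cst.
by move=> v; apply: Ck_ext (IH 0) => y _; rewrite derive_cst.
Qed.

Lemma Ck_add k f g : Ck k U f -> Ck k U g -> Ck k U (fun y => f y + g y).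
Proof.
elim: k f g => [|k IH] f g [c D] [c' D']; split => //;
  try by move=> x Ux; apply: continuousD; [exact: c|exact: c'].
case: D D' => d D [d' D']; split; first by move=> x v Ux; apply: derivableD; [exact: d|exact: d'].
move=> v; apply: Ck_ext (IH _ _ (D v) (D' v)) => y Uy.
by rewrite [RHS]deriveD //; [exact: d|exact: d'].
Qed.

Lemma Ck_mul k f g : Ck k U f -> Ck k U g -> Ck k U (fun y => f y * g y).
Proof.
elim: k f g => [|k IH] f g F G; have [c D] := F; have [c' D'] := G; split => //;
  try by move=> x Ux; apply: continuousM; [exact: c|exact: c'].
case: D D' => d D [d' D']; split; first by move=> x v Ux; apply: derivableM; [exact: d|exact: d'].
(* The Leibniz rule involves [f] and [g] themselves, which [CkS] brings down to order k. *)
move=> v; apply: Ck_ext (Ck_add (IH _ _ (D v) (CkS G)) (IH _ _ (CkS F) (D' v))) => y Uy.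
by have [_ ->] := is_deriveMf (derivableP (d y v Uy)) (derivableP (d' y v Uy)).
Qed.

Lemma sm_add f g : sm U f -> sm U g -> sm U (fun y => f y + g y).
Proof. by move=> F G k; apply: Ck_add. Qed.

Lemma sm_mul f g : sm U f -> sm U g -> sm U (fun y => f y * g y).
Proof. by move=> F G k; apply: Ck_mul. Qed.

Lemma sm_opp f : sm U f -> sm U (fun y => - f y).
Proof.
move=> F; apply: (sm_ext (f := fun y => (-1) * f y)) => [y _|]; first by rewrite mulN1r.
by apply: sm_mul => //; exact: sm_cst.
Qed.

Lemma sm_sub_fun f g : sm U f -> sm U g -> sm U (fun y => f y - g y).
Proof. by move=> F G; apply: sm_add => //; exact: sm_opp. Qed.

Lemma sm_sum (I : Type) (r : seq I) (P : pred I) (h : I -> E -> R) :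
  (forall i, P i -> sm U (h i)) -> sm U (fun y => \sum_(i <- r | P i) h i y).
Proof.
move=> H; elim: r => [|i r IH].
  by apply: sm_ext (sm_cst 0) => y _; rewrite big_nil.
case Pi : (P i).
  by apply: sm_ext (sm_add (H _ Pi) IH) => y _; rewrite big_cons Pi.
by apply: sm_ext IH => y _; rewrite big_cons Pi.
Qed.

Lemma sm_prod (I : Type) (r : seq I) (P : pred I) (h : I -> E -> R) :
  (forall i, P i -> sm U (h i)) -> sm U (fun y => \prod_(i <- r | P i) h i y).
Proof.
move=> H; elim: r => [|i r IH].
  by apply: sm_ext (sm_cst 1) => y _; rewrite big_nil.
case Pi : (P i).
  by apply: sm_ext (sm_mul (H _ Pi) IH) => y _; rewrite big_cons Pi.
by apply: sm_ext IH => y _; rewrite big_cons Pi.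
Qed.

Lemma Ck_opp k f : Ck k U f -> Ck k U (fun y => - f y).
Proof.
move=> F; apply: (Ck_ext (f := fun y => (-1) * f y)) => [y _|]; first by rewrite mulN1r.
by apply: Ck_mul => //; exact: sm_cst.
Qed.

(** Induction on the order: the derivative of 1/f is -f'/f^2, and its factors 1/f are covered by the
    induction hypothesis. *)
Lemma sm_inv f : (forall y, U y -> f y != 0) -> sm U f -> sm U (fun y => (f y)^-1).
Proof.
move=> f0 F k; elim: k => [|k IH]; split => //;
  try by move=> x Ux; apply: continuousV; [exact: f0|exact: sm_cont Ux].
split; first by move=> x v Ux; apply: derivableV; [exact: f0|exact: sm_derivable Ux].
move=> v; apply: Ck_ext (Ck_opp (Ck_mul (Ck_mul (sm_derive v F k) IH) IH)) => y Uy.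
by have [_ ->] := is_deriveVf (f0 y Uy) (sm_is_derive v F Uy).
Qed.

Lemma sm_sqrt f : (forall y, U y -> 0 < f y) -> sm U f -> sm U (fun y => Num.sqrt (f y)).
Proof.
move=> f0 F.
have c x : U x -> {for x, continuous (fun y => Num.sqrt (f y))}.
  by move=> Ux; apply: continuous_comp; [exact: sm_cont Ux|exact: sqrt_continuous].
have s0 y : U y -> Num.sqrt (f y) != 0 by move=> Uy; rewrite gt_eqF // sqrtr_gt0 f0.
have V x : U x -> {for x, continuous (fun y => (Num.sqrt (f y))^-1)}.
  by move=> Ux; apply: continuousV; [exact: s0|exact: c].
have D y v : U y -> is_derive y v (fun y => Num.sqrt (f y)) ((2 * Num.sqrt (f y))^-1 * 'D_v f y).
  by move=> Uy; apply: is_derive_sqrtf; [exact: f0|exact: sm_is_derive Uy].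
(* The root and its inverse share one induction: the derivative of the root is f'/2 times the
   inverse, and that of the inverse is minus the derivative of the root times the square of the
   inverse. *)
suff W k : Ck k U (fun y => Num.sqrt (f y)) /\ Ck k U (fun y => (Num.sqrt (f y))^-1).
  by move=> k; exact: (W k).1.
elim: k => [|k [IH1 IH2]].
  by split; split.
have S1 : Ck k.+1 U (fun y => Num.sqrt (f y)).
  split => //; split; first by move=> x v Ux; have [] := D x v Ux.
  move=> v.
  apply: Ck_ext (Ck_mul (Ck_mul (sm_cst (2^-1) k) IH2) (sm_derive v F k)) => y Uy.
  by have [_ ->] := D y v Uy; rewrite invfM.
split => //; split => //; split.
  by move=> x v Ux; apply: derivableV; [exact: s0|have [] := D x v Ux].
move=> v; have [_ [_ S2]] := S1.
apply: Ck_ext (Ck_opp (Ck_mul (Ck_mul (S2 v) IH2) IH2)) => y Uy.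
have [d _] := D y v Uy.
by have [_ ->] := @is_deriveVf R E (fun y => Num.sqrt (f y)) y v _ (s0 y Uy) (derivableP d).
Qed.

End Smooth.

Section Preliminaries.
Variable R : realType.

Lemma continuous_sumf (T : topologicalType) (I : Type) (r : seq I) (h : I -> T -> R) x :
  (forall i, {for x, continuous (h i)}) ->
  {for x, continuous (fun y => \sum_(i <- r) h i y)}.
Proof.
move=> H; elim: r => [|i r IH].
  rewrite (_ : (fun y => _) = fun=> 0); first exact: cst_continuous.
  by apply/funext => y; rewrite big_nil.
rewrite (_ : (fun y => _) = fun y => h i y + \sum_(i <- r) h i y).
  by apply: cvgD; [exact: H|exact: IH].
by apply/funext => y; rewrite big_cons.
Qed.

Lemma linear_approx_differentiable (V W : normedModType R) (f : V -> W)
    (L : {linear V -> W}) x : continuous L ->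
  (forall eps : R, 0 < eps -> \forall h \near (0 : V),
     `|f (h + x) - (f x + L h)| <= eps * `|h|) -> differentiable f x.
Proof.
move=> cL H.
suff E1 : f \o shift x = cst (f x) + L +o_ 0 id.
  by apply/diff_locallyP; rewrite (@diff_unique R V W f L x).
by apply/eqaddoP => eps eps0; exact: H.
Qed.

Lemma derive_curve (V : normedModType R) (f : V -> R) (x v : V) (a b : R -> R) (da db : R) :
  is_derive (0 : R) 1 a da -> is_derive (0 : R) 1 b db ->
  differentiable f (a 0 *: x + b 0 *: v) ->
  {for (0 : R), continuous (fun t => a t *: x + b t *: v)} /\
  'D_1 (fun t => f (a t *: x + b t *: v)) (0 : R)
  = 'd f (a 0 *: x + b 0 *: v) (da *: x + db *: v).
Proof.
move=> [da1 <-] [db1 <-] df.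
have a1 : differentiable a (0 : R) by exact/derivable1_diffP.
have b1 : differentiable b (0 : R) by exact/derivable1_diffP.
have a2 : differentiable (fun t => a t *: x) (0 : R) by exact: differentiableZl.
have b2 : differentiable (fun t => b t *: v) (0 : R) by exact: differentiableZl.
have dc : differentiable (fun t => a t *: x + b t *: v) (0 : R) by exact: differentiableD.
split; first exact: differentiable_continuous.
rewrite deriveE; last exact: (differentiable_comp dc).
rewrite [LHS](congr1 (fun F : R -> R => F 1) (diff_comp dc df)) /=; congr ('d f _ _).
rewrite [LHS](congr1 (fun F : R -> V => F 1) (diffD a2 b2)).
rewrite -[LHS]/('d (fun t => a t *: x) (0 : R) 1 + 'd (fun t => b t *: v) (0 : R) 1).
by rewrite !diffZl // !deriveE.
Qed.
End Preliminaries.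

(** * Symmetry of mixed directional derivatives *)

Section MixedDerivatives.
Variables (R : realType) (E : normedModType R).
Implicit Types (f : E -> R) (U : set E) (x u v : E).

(** The mean value theorem is applied twice: along [u] to the increment of [f] over [t *: v], then
    along [v] to ['D_u f]. *)
Lemma second_difference U f x u v (t : R) : (forall y, U y -> derivable f y u) -> (forall y, U y -> derivable ('D_u f) y v) ->
  (forall s1 s2, `|s1| <= `|t| -> `|s2| <= `|t| -> U (x + s1 *: u + s2 *: v)) ->
  exists s1, exists s2, [/\ `|s1| <= `|t|, `|s2| <= `|t| &
    (f (x + t *: u + t *: v) - f (x + t *: u)) - (f (x + t *: v) - f x) =
    t * (t * 'D_v ('D_u f) (x + s1 *: u + s2 *: v))].
Proof.
move=> d1 d2 HU.
have U0 s1 : `|s1| <= `|t| -> U (x + s1 *: u).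
  by move=> h; have := HU s1 0 h; rewrite normr0 scale0r addr0; exact.
have D s1 : `|s1| <= `|t| -> is_derive (x + s1 *: u) u (fun y => f (y + t *: v) - f y)
   ('D_u f (x + s1 *: u + t *: v) - 'D_u f (x + s1 *: u)).
  move=> h; apply: is_deriveBf; last exact: derivableP (d1 _ (U0 _ h)).
  by apply: (@is_derive_shiftf R E f _ u (t *: v)); exact: (d1 _ (HU s1 t h (lexx _))).
have [|s1 h1 E1] := @MVT_line R E (fun y => f (y + t *: v) - f y) x u t.
  by move=> s h; case: (D s h).
have [|s2 h2 E2] := @MVT_line R E ('D_u f) (x + s1 *: u) v t.
  by move=> s h; exact: (d2 _ (HU _ _ h1 h)).
exists s1, s2; split => //; rewrite E1; congr (_ * _).
by have [_ ->] := D s1 h1.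
Qed.

(** The second difference is symmetric in [u] and [v], so the two mixed derivatives agree at some
    pair of points of a small parallelogram at [x]. Continuity then bounds the distance [d] of their
    values at [x] by less than [d]. *)
Lemma derive_comm U f x u v : open U -> U x ->
  (forall y, U y -> derivable f y u) -> (forall y, U y -> derivable f y v) ->
  (forall y, U y -> derivable ('D_u f) y v) -> (forall y, U y -> derivable ('D_v f) y u) ->
  {for x, continuous ('D_u ('D_v f))} -> {for x, continuous ('D_v ('D_u f))} ->
  'D_u ('D_v f) x = 'D_v ('D_u f) x.
Proof.
move=> oU Ux du dv duv dvu c1 c2; apply/eqP; rewrite -subr_eq0 -normr_le0 leNgt; apply/negP => d0.
set d := `|_| in d0.
have d2 : 0 < d / 2 by rewrite divr_gt0.
have : \forall y \near x, [/\ U y, `|'D_u ('D_v f) x - 'D_u ('D_v f) y| < d / 2 &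
     `|'D_v ('D_u f) x - 'D_v ('D_u f) y| < d / 2].
  have n3 : nbhs x U by exact: open_nbhs_nbhs.
  move/cvgrPdist_lt : c1 => /(_ _ d2) n1; move/cvgrPdist_lt : c2 => /(_ _ d2) n2.
  apply: (nearS2 _ n3 (nearS2 (fun y p q => conj p q) n1 n2)).
  by move=> y h1 [h2 h3]; exact: (And3 h1 h2 h3).
case/nbhs_ballP => r /= r0 Hr.
(* This size keeps the parallelogram in the ball of radius [r]; the summand 1 makes the denominator
   positive. *)
pose t : R := r / (`|u| + `|v| + 1).
have den : 0 < `|u| + `|v| + 1 by rewrite ltr_wpDl // addr_ge0.
have t0 : 0 < t by rewrite divr_gt0.
have HB s1 s2 : `|s1| <= `|t| -> `|s2| <= `|t| -> ball x r (x + s1 *: u + s2 *: v).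
  rewrite (gtr0_norm t0) => h1 h2; rewrite -ball_normE /= -addrA opprD addrA subrr add0r normrN.
  apply: (le_lt_trans (ler_normD _ _)); rewrite !normrZ.
  apply: (@le_lt_trans _ _ (t * `|u| + t * `|v|)); first by rewrite lerD // ler_wpM2r.
  rewrite -mulrDr /t mulrAC ltr_pdivrMr // ltr_pM2l // ltrDl //.
clearbody t.
have [|s1 [s2 [h1 h2 E1]]] := @second_difference U f x u v t du duv.
  by move=> s1 s2 h1 h2; have [] := Hr _ (HB _ _ h1 h2).
have [|s3 [s4 [h3 h4 E2]]] := @second_difference U f x v u t dv dvu.
  by move=> s3 s4 h3 h4; rewrite addrAC; have [] := Hr _ (HB _ _ h4 h3).
have E3 : 'D_v ('D_u f) (x + s1 *: u + s2 *: v) = 'D_u ('D_v f) (x + s4 *: u + s3 *: v).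
  apply: (mulfI (lt0r_neq0 t0)); apply: (mulfI (lt0r_neq0 t0)).
  have aux (a b p q : R) : (a - b) - (p - q) = (a - p) - (b - q) by ring.
  have X1 : x + s3 *: v + s4 *: u = x + s4 *: u + s3 *: v by exact: addrAC.
  have X2 : x + t *: v + t *: u = x + t *: u + t *: v by exact: addrAC.
  rewrite X2 X1 in E2.
  exact: (etrans (esym E1) (etrans (aux _ _ _ _) E2)).
have [_ _ A1] := Hr _ (HB _ _ h1 h2).
have [_ A2 _] := Hr _ (HB _ _ h4 h3).
have : d < d.
  have aux (a b p : R) : a - b = (a - p) - (b - p) by ring.
  rewrite [X in _ < X](splitr d) {1}/d.
  rewrite (aux _ _ ('D_u ('D_v f) (x + s4 *: u + s3 *: v))) -{2}E3.
  exact: (le_lt_trans (ler_normB _ _) (ltrD A2 A1)).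
by rewrite ltxx.
Qed.

End MixedDerivatives.

(** * Differentiability and linear dependence on the direction *)

Section Differentiability.
Variables (R : realType) (n : nat).
Local Notation E := 'rV[R]_n.
Local Notation e j := (delta_mx 0 j : E).
Implicit Types (f g : E -> R) (U : set E) (x u v : E).

Lemma ler_coord_norm (x : E) j : `|x 0 j| <= `|x|.
Proof.
rewrite [leRHS]/Num.Def.normr /= mx_normrE.
exact: (le_bigmax _ (fun i : 'I_1 * 'I_n => `|x i.1 i.2|) (0, j)).
Qed.

Lemma norm_ler (x : E) (r : R) : 0 <= r -> (forall j, `|x 0 j| <= r) -> `|x| <= r.
Proof.
move=> r0 H; rewrite [leLHS]/Num.Def.normr /= mx_normrE bigmax_le // => -[i j] _ /=.
by rewrite ord1.
Qed.

Definition lform (c : 'cV[R]_n) (h : E) : R := (h *m c) 0 0.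
Lemma lform_linear c : linear_for *%R (lform c).
Proof. by move=> a u v; rewrite /lform mulmxDl -scalemxAl !mxE. Qed.
HB.instance Definition _ c :=
  GRing.isLinear.Build R E R *%R (lform c) (lform_linear c).

Lemma lformE c h : lform c h = \sum_j h 0 j * c j 0.
Proof. by rewrite /lform mxE. Qed.

Lemma lform_continuous c : continuous (lform c).
Proof.
move=> x; rewrite (_ : lform c = fun h => \sum_j h 0 j * c j 0); last first.
  by apply/funext => h; rewrite lformE.
apply: continuous_sumf => j.
apply: (@continuousM _ _ (fun y : E => y 0 j) (fun=> c j 0) x).
  exact: (@coord_continuous R 1 n 0 j x).
exact: cst_continuous.
Qed.

(* The increment is split along the coordinate axes and the mean value theorem is
   applied to each segment. *)
Lemma C1_differentiable U f x : open U -> U x ->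
  (forall y v, U y -> derivable f y v) -> (forall v, {for x, continuous ('D_v f)}) ->
  differentiable f x.
Proof.
move=> oU Ux df cf.
pose c : 'cV[R]_n := \col_j 'D_(e j) f x.
apply: (@linear_approx_differentiable R E R f (lform c) x); first exact: lform_continuous.
move=> eps eps0.
(* The denominator n + 1 covers n = 0; the n terms of the telescoping sum still add up to at most
   eps |h|. *)
have e0 : 0 < eps / n.+1%:R :> R by rewrite divr_gt0.
have : \forall y \near x, U y /\ forall j, `|'D_(e j) f x - 'D_(e j) f y| < eps / n.+1%:R.
  apply: filterI; first exact: open_nbhs_nbhs.
  by apply: near_forall => j; have /cvgrPdist_lt := cf (e j); exact.
case/nbhs_ballP => d /= d0 Hd.
near=> h.
have hd : `|h| < d by near: h; apply/nbhs_ballP; exists d => // z; rewrite -ball_normE /= sub0r normrN.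
(* [T k] keeps the first [k] coordinates of [h], so consecutive points differ along one axis. *)
pose T k : E := \row_j (if (j < k)%N then h 0 j else 0).
have tel : f (h + x) - f x = \sum_(k < n) (f (x + T k.+1) - f (x + T k)).
  rewrite -(big_mkord xpredT (fun k => f (x + T k.+1) - f (x + T k))).
  rewrite telescope_sumr // (_ : T n = h); last by apply/rowP => j; rewrite !mxE ltn_ord.
  rewrite (_ : T 0%N = 0); last by apply/rowP => j; rewrite !mxE.
  by rewrite addr0 [h + x]addrC.
have TS (k : 'I_n) : T k.+1 = T k + h 0 k *: e k.
  apply/rowP => j; rewrite !mxE /= ltnS leq_eqVlt -val_eqE /=.
  have [jk|jk] := eqVneq (val j) (val k); last by rewrite mulr0 addr0.
  by rewrite jk ltnn mulr1 add0r; congr (h 0 _); apply/val_inj.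
have nT (k : 'I_n) (t : R) : `|t| <= `|h 0 k| -> `|T k + t *: e k| <= `|h|.
  move=> th; apply: norm_ler => // j; rewrite !mxE /=.
  have [->|jk] := eqVneq j k; first by rewrite ltnn mulr1 add0r (le_trans th) ?ler_coord_norm.
  by rewrite mulr0 addr0; case: ifP => _; rewrite ?normr0 ?ler_coord_norm.
have inB z : `|z| <= `|h| -> U (x + z) /\ forall j, `|'D_(e j) f x - 'D_(e j) f (x + z)| < eps / n.+1%:R.
  move=> zh; apply: Hd; rewrite -ball_normE /= opprD addrA subrr add0r normrN.
  exact: le_lt_trans hd.
rewrite opprD addrA tel lformE -sumrB.
apply: (le_trans (ler_norm_sum _ _ _)).
apply: (@le_trans _ _ (\sum_(k < n) (eps / n.+1%:R * `|h|))); last first.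
  rewrite sumr_const card_ord -[X in X <= _]mulr_natl mulrA ler_wpM2r //.
  rewrite mulrCA ger_pMr // ler_pdivrMr // mul1r ler_nat //.
apply: ler_sum => k _; rewrite mxE TS addrA.
have [|t th ->] := @MVT_line R E f (x + T k) (e k) (h 0 k).
  by move=> t th; apply: df; rewrite -addrA; exact: (inB _ (nT _ _ th)).1.
rewrite -mulrBr normrM mulrC ler_pM //; last exact: ler_coord_norm.
by rewrite distrC -addrA ltW //; exact: (inB _ (nT _ _ th)).2.
Unshelve. all: by end_near. Qed.

Lemma sm_differentiable U f x : open U -> sm U f -> U x -> differentiable f x.
Proof.
move=> oU F Ux; apply: (C1_differentiable oU Ux).
  by move=> y v; exact: sm_derivable.
by move=> v; apply: sm_cont Ux; exact: sm_derive.
Qed.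

Lemma sm_deriveE U f x v : open U -> sm U f -> U x ->
  'D_v f x = \sum_j v 0 j * 'D_(e j) f x.
Proof.
move=> oU F Ux; have df := sm_differentiable oU F Ux.
rewrite deriveE // {1}[v]row_sum_delta linear_sum; apply: eq_bigr => j _.
by rewrite linearZ deriveE.
Qed.

Lemma sm_derive_comm U f x u v : open U -> sm U f -> U x ->
  'D_u ('D_v f) x = 'D_v ('D_u f) x.
Proof.
move=> oU F Ux; apply: (derive_comm oU Ux).
- by move=> y Uy; exact: sm_derivable F Uy.
- by move=> y Uy; exact: sm_derivable F Uy.
- by move=> y Uy; exact: (sm_derivable (sm_derive u F) Uy).
- by move=> y Uy; exact: (sm_derivable (sm_derive v F) Uy).
- exact: (sm_cont (sm_derive u (sm_derive v F)) Ux).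
- exact: (sm_cont (sm_derive v (sm_derive u F)) Ux).
Qed.

Lemma dotC (m : nat) (u v : 'rV[R]_m) : dot u v = dot v u.
Proof. by apply: eq_bigr => k _; rewrite mulrC. Qed.
Lemma dotDl (m : nat) (u v w : 'rV[R]_m) : dot (u + v) w = dot u w + dot v w.
Proof. by rewrite /dot -big_split; apply: eq_bigr => k _; rewrite mxE mulrDl. Qed.
Lemma dotZl (m : nat) (a : R) (u v : 'rV[R]_m) : dot (a *: u) v = a * dot u v.
Proof. by rewrite /dot mulr_sumr; apply: eq_bigr => k _; rewrite mxE mulrA. Qed.
Lemma dotDr (m : nat) (u v w : 'rV[R]_m) : dot u (v + w) = dot u v + dot u w.
Proof. by rewrite dotC dotDl !(dotC u). Qed.
Lemma dotZr (m : nat) (a : R) (u v : 'rV[R]_m) : dot u (a *: v) = a * dot u v.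
Proof. by rewrite dotC dotZl dotC. Qed.
Lemma dot_ge0 (m : nat) (u : 'rV[R]_m) : 0 <= dot u u.
Proof. by apply: sumr_ge0 => k _; rewrite -expr2 sqr_ge0. Qed.
Lemma dot_eq0 (m : nat) (u : 'rV[R]_m) : (dot u u == 0) = (u == 0).
Proof.
apply/eqP/eqP => [|->]; last by rewrite /dot big1 // => k _; rewrite mxE mul0r.
move=> /eqP; rewrite psumr_eq0; last by move=> k _; rewrite -expr2 sqr_ge0.
move=> /allP H; apply/rowP => k; rewrite mxE.
by have := H k (mem_index_enum k); rewrite -expr2 sqrf_eq0 => /eqP.
Qed.

(* f is differentiated along the rational parametrization
   ((1 - t^2 k) x + 2 t v) / (1 + t^2 k), k = |v|^2, of a circle on the sphere. *)
Lemma derive_tangent U f x v : open U -> sm U f -> U x -> dot x x = 1 ->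
  dot v x = 0 -> (forall y, U y -> dot y y = 1 -> f y = 0) -> 'D_v f x = 0.
Proof.
move=> oU F Ux xx vx fy.
pose k := dot v v; pose a (t : R) := (1 - t ^+ 2 * k) / (1 + t ^+ 2 * k).
pose b (t : R) := 2 * t / (1 + t ^+ 2 * k).
have den (t : R) : 1 + t ^+ 2 * k != 0.
  by rewrite gt_eqF // ltr_wpDr // mulr_ge0 ?sqr_ge0 // dot_ge0.
pose c (t : R) := a t *: x + b t *: v.
have cS t : dot (c t) (c t) = 1.
  rewrite /c !(dotDl, dotDr, dotZl, dotZr) (dotC x v) vx xx -/k /a /b.
  by field.
have c0 : c 0 = x by rewrite /c /a /b expr0n /= mul0r subr0 addr0 divr1 mulr0 mul0r scale1r scale0r addr0.
have pw : is_derive (0 : R) 1 (fun t : R => t ^+ 2 * k) 0.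
  have := @is_deriveMf R R (fun t => t ^+ 2) (fun=> k) 0 1 _ _ (is_deriveX 2 (is_derive_id (0:R) (1:R))) (is_derive_cst _ _ _).
  by rewrite /= expr1 mulr0 scale0r mul0r mulr0 addr0.
have inv1 : is_derive (0 : R) 1 (fun t : R => (1 + t ^+ 2 * k)^-1) 0.
  have := @is_deriveVf R R (fun t => 1 + t ^+ 2 * k) 0 1 _ (den 0) (is_deriveDf (is_derive_cst _ _ _) pw).
  by rewrite add0r !mul0r oppr0.
have da : is_derive (0 : R) 1 a 0.
  have := is_deriveMf (is_deriveBf (is_derive_cst (1:R) (0:R) (1:R)) pw) inv1.
  by rewrite subr0 mul0r mulr0 addr0.
have db : is_derive (0 : R) 1 b 2.
  have := is_deriveMf (is_deriveMf (is_derive_cst (2:R) (0:R) (1:R)) (is_derive_id (0:R) (1:R))) inv1.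
  by rewrite mul0r add0r mulr1 expr0n /= mul0r addr0 invr1 !mulr1 !mulr0 addr0.
have df : differentiable f (c 0) by rewrite c0; exact: sm_differentiable F Ux.
have [cc] := derive_curve da db df.
rewrite -[a 0 *: x + _]/(c 0) c0 scale0r add0r.
have -> : 'd f x (2 *: v) = 2 * 'D_v f x.
  by rewrite deriveE; [rewrite linearZ|exact: sm_differentiable F Ux].
have fc : \forall t \near (0 : R), f (c t) = cst 0 t.
  have : nbhs (0 : R) (c @^-1` U) by apply: cc; rewrite -/(c 0) c0; exact: open_nbhs_nbhs.
  by apply: filterS => t Ut; apply: fy.
rewrite (near_eq_derive _ fc) derive_cst => /esym.
by move/eqP; rewrite mulf_eq0 pnatr_eq0 /= => /eqP.
Qed.
End Differentiability.

(** * Tangential calculus and Simons' identity *)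

(** Lagrange's identity: the difference of the two sides is half the sum of the squares of the
    minors u_i v_j - u_j v_i. *)
Lemma cauchy_schwarz_sum (R : realDomainType) (J : finType) (u v : J -> R) :
  (\sum_i u i * v i) ^+ 2 <= (\sum_i u i ^+ 2) * (\sum_i v i ^+ 2).
Proof.
have : 0 <= \sum_i \sum_j (u i * v j - u j * v i) ^+ 2.
  by apply: sumr_ge0 => i _; apply: sumr_ge0 => j _; exact: sqr_ge0.
rewrite (eq_bigr (fun i => \sum_j (u i ^+ 2 * v j ^+ 2 + (v i ^+ 2 * u j ^+ 2 +
   (- 2 * (u i * v i)) * (u j * v j))))); last first.
  by move=> i _; apply: eq_bigr => j _; ring.
under eq_bigr do rewrite !big_split /= -!mulr_sumr.
rewrite !big_split /= -!mulr_suml -mulr_sumr; set S := \sum_i u i * v i; nra.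
Qed.

Section FiniteSums.
Variables (R : comPzRingType) (m : nat).
Implicit Types (q : 'I_m -> 'I_m -> R) (u v : 'I_m -> R).

(** Meant for q = delta_c A, u = N and v the row c of A^2: the added terms cancel the normal
    components of q. The two mixed terms contribute -2 |v|^2 each and the two squares |v|^2 each. *)
Lemma sum_sqr_normal_part q u v : \sum_a u a * u a = 1 ->
  (forall b, \sum_a u a * q a b = - v b) -> (forall a, \sum_b u b * q a b = - v a) ->
  \sum_a u a * v a = 0 ->
  \sum_a \sum_b (q a b + u a * v b + u b * v a) ^+ 2 =
  \sum_a \sum_b q a b * q a b - 2 * \sum_b v b * v b.
Proof.
move=> u1 uq1 uq2 uv.
rewrite (eq_bigr (fun a => \sum_b (q a b * q a b + (2 * (v b * (u a * q a b)) +
  (2 * v a * (u b * q a b) + ((u a * u a) * (v b * v b) + ((v a * v a) * (u b * u b) +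
   2 * (u a * v a) * (u b * v b)))))))); last first.
  by move=> a _; apply: eq_bigr => b _; ring.
under eq_bigr do rewrite !big_split /=.
rewrite !big_split /=.
have -> : \sum_i \sum_j 2 * (v j * (u i * q i j)) = - 2 * \sum_b v b * v b.
  rewrite exchange_big mulr_sumr; apply: eq_bigr => b _ /=.
  by rewrite -!mulr_sumr uq1; ring.
have -> : \sum_i \sum_j 2 * v i * (u j * q i j) = - 2 * \sum_b v b * v b.
  by rewrite mulr_sumr; apply: eq_bigr => a _ /=; rewrite -!mulr_sumr uq2; ring.
have -> : \sum_i \sum_j u i * u i * (v j * v j) = \sum_b v b * v b.
  by under eq_bigr do rewrite -mulr_sumr; rewrite -mulr_suml u1 mul1r.
have -> : \sum_i \sum_j v i * v i * (u j * u j) = \sum_b v b * v b.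
  by under eq_bigr do rewrite -mulr_sumr; rewrite -mulr_suml u1 mulr1.
have -> : \sum_i \sum_j 2 * (u i * v i) * (u j * v j) = 0.
  by rewrite big1 // => a _; rewrite -mulr_sumr uv mulr0.
by ring.
Qed.

Lemma sum3_split (k l : R) (q r : 'I_m -> 'I_m -> 'I_m -> R) :
  \sum_c \sum_a \sum_b (k * q c a b + l * r c a b) =
  k * (\sum_c \sum_a \sum_b q c a b) + l * \sum_c \sum_a \sum_b r c a b.
Proof.
rewrite !mulr_sumr -big_split; apply: eq_bigr => c _ /=.
rewrite !mulr_sumr -big_split; apply: eq_bigr => a _ /=.
by rewrite !mulr_sumr -big_split.
Qed.
End FiniteSums.

(* Locked because unification would otherwise unfold the limits hidden in 'D_v. *)
HB.lock Definition dl (R : realType) (n : nat) (T : 'I_n.+1 -> 'I_n -> 'rV[R]_n -> R)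
  (a : 'I_n.+1) (f : 'rV[R]_n -> R) : 'rV[R]_n -> R :=
  fun x => \sum_j T a j x * 'D_(delta_mx 0 j) f x.
Canonical dl_unlockable := Unlockable dl.unlock.

Section Frame.
Variables (R : realType) (n : nat).
Local Notation E := 'rV[R]_n.
Local Notation e j := (delta_mx 0 j : E).
Local Notation I := 'I_n.+1.
Variables (U : set E) (oU : open U).
Variable T : I -> 'I_n -> E -> R.
Hypothesis smT : forall a j, sm U (T a j).
Implicit Types (f g : E -> R) (x y : E) (a b c d : I).
Local Notation smD := (sm_add oU).
Local Notation smM := (sm_mul oU).

Local Notation dl := (dl T).

Lemma dlE a f x : dl a f x = \sum_j T a j x * 'D_(e j) f x.
Proof. by rewrite unlock. Qed.

Lemma sm_dl a f : sm U f -> sm U (dl a f).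
Proof. by move=> F; rewrite unlock; apply: sm_sum => // j _; apply: sm_mul => //; exact: sm_derive. Qed.

Lemma dl_ext a f g x : U x -> (forall y, U y -> f y = g y) -> dl a f x = dl a g x.
Proof. by move=> Ux H; rewrite unlock; apply: eq_bigr => j _; rewrite (derive_eqU oU (e j) Ux H). Qed.

Lemma dl_cst a (k : R) x : dl a (fun=> k) x = 0.
Proof. by rewrite !dlE big1 // => j _; rewrite derive_cst mulr0. Qed.

Lemma dl_mul a f g x : sm U f -> sm U g -> U x ->
  dl a (fun y => f y * g y) x = dl a f x * g x + f x * dl a g x.
Proof.
move=> F G Ux; rewrite !dlE mulr_suml mulr_sumr -big_split; apply: eq_bigr => j _ /=.
have [_ ->] := is_deriveMf (sm_is_derive (e j) F Ux) (sm_is_derive (e j) G Ux).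
by ring.
Qed.

Lemma dl_add a f g x : sm U f -> sm U g -> U x ->
  dl a (fun y => f y + g y) x = dl a f x + dl a g x.
Proof.
move=> F G Ux; rewrite !dlE -big_split; apply: eq_bigr => j _ /=.
have [_ ->] := is_deriveDf (sm_is_derive (e j) F Ux) (sm_is_derive (e j) G Ux).
by rewrite mulrDr.
Qed.

Lemma dl_opp a f x : sm U f -> U x -> dl a (fun y => - f y) x = - dl a f x.
Proof.
move=> F Ux; rewrite !dlE -sumrN; apply: eq_bigr => j _ /=.
by have [_ ->] := is_deriveNf (sm_is_derive (e j) F Ux); rewrite mulrN.
Qed.

Lemma dl_sub a f g x : sm U f -> sm U g -> U x ->
  dl a (fun y => f y - g y) x = dl a f x - dl a g x.
Proof. by move=> F G Ux; rewrite dl_add ?dl_opp //; exact: sm_opp. Qed.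

Lemma dl_sum a (J : finType) (h : J -> E -> R) x : (forall i, sm U (h i)) -> U x ->
  dl a (fun y => \sum_i h i y) x = \sum_i dl a (h i) x.
Proof.
move=> H Ux; rewrite dlE; under [RHS]eq_bigr do rewrite dlE.
rewrite exchange_big; apply: eq_bigr => j _ /=.
have [|_ ->] := @is_deriveSf R E J (index_enum J) xpredT h x (e j) (fun i => 'D_(e j) (h i) x).
  by move=> i _; exact: sm_is_derive (H i) Ux.
by rewrite mulr_sumr.
Qed.

Lemma dl_scale a (k : R) f x : sm U f -> U x -> dl a (fun y => k * f y) x = k * dl a f x.
Proof. by move=> F Ux; rewrite dl_mul ?dl_cst ?mul0r ?add0r //; exact: sm_cst. Qed.

(** The second order terms cancel by the symmetry of mixed derivatives, so the commutator is a
    vector field. *)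
Lemma dl_comm_raw a b f x : sm U f -> U x ->
  dl a (dl b f) x - dl b (dl a f) x =
  \sum_j (dl a (T b j) x - dl b (T a j) x) * 'D_(e j) f x.
Proof.
move=> F Ux.
have H a' b' : dl a' (dl b' f) x = \sum_j dl a' (T b' j) x * 'D_(e j) f x
    + \sum_j \sum_i T a' i x * T b' j x * 'D_(e i) ('D_(e j) f) x.
  rewrite (dl_ext a' Ux (fun y _ => dlE b' f y)) dl_sum //; last by move=> j; apply: sm_mul => //; exact: sm_derive.
  rewrite -big_split; apply: eq_bigr => j _ /=.
  rewrite dl_mul //; last exact: sm_derive.
  by congr (_ + _); rewrite dlE mulr_sumr; apply: eq_bigr => i _; ring.
rewrite !H [X in _ - (_ + X)](_ : _ = \sum_j \sum_i T a i x * T b j x * 'D_(e i) ('D_(e j) f) x).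
  rewrite opprD addrACA subrr addr0 -sumrB; apply: eq_bigr => j _.
  by rewrite mulrBl.
rewrite exchange_big; apply: eq_bigr => j _; apply: eq_bigr => i _.
by rewrite (sm_derive_comm _ _ oU F Ux) [T b _ _ * _]mulrC.
Qed.

(* X: components of the immersion, N: components of a unit normal, T = J^T g^-1. *)
Variables (X N : I -> E -> R).
Hypothesis smX : forall a, sm U (X a).
Hypothesis smN : forall a, sm U (N a).
Hypothesis N1 : forall x, U x -> \sum_a N a x * N a x = 1.
Hypothesis NT : forall j x, U x -> \sum_a N a x * T a j x = 0.
Hypothesis TX : forall i j x, U x -> \sum_c T c i x * 'D_(e j) (X c) x = (i == j)%:R.
Hypothesis dX : forall a b x, U x -> dl a (X b) x = (a == b)%:R - N a x * N b x.
Hypothesis symN : forall a b x, U x -> dl a (N b) x = dl b (N a) x.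

Definition A a b : E -> R := dl a (N b).
Definition A2 a b : E -> R := fun x => \sum_d A a d x * A d b x.
Definition sA : E -> R := fun x => \sum_a \sum_b A a b x * A a b x.
Definition trA : E -> R := fun x => \sum_a A a a x.

Lemma smA a b : sm U (A a b). Proof. exact: sm_dl. Qed.
Lemma smA2 a b : sm U (A2 a b).
Proof. by apply: sm_sum => // d _; apply: sm_mul => //; exact: smA. Qed.
Lemma sm_sA : sm U sA.
Proof. by apply: sm_sum => // a _; apply: sm_sum => // b _; apply: sm_mul => //; exact: smA. Qed.
Lemma sm_trA : sm U trA.
Proof. by apply: sm_sum => // a _; exact: smA. Qed.

Lemma AC a b x : U x -> A a b x = A b a x. Proof. exact: symN. Qed.
Lemma A2C a b x : U x -> A2 a b x = A2 b a x.
Proof. by move=> Ux; apply: eq_bigr => d _; rewrite mulrC !(AC _ d Ux) (AC d a Ux). Qed.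

Lemma NA b x : U x -> \sum_a N a x * A b a x = 0.
Proof.
move=> Ux; have : dl b (fun y => \sum_a N a y * N a y) x = 0.
  by rewrite (dl_ext b Ux N1) dl_cst.
rewrite dl_sum //; last by move=> a; apply: sm_mul.
rewrite (eq_bigr (fun a => 2 * (N a x * A b a x))); last first.
  by move=> a _; rewrite dl_mul // -/(A b a); ring.
by rewrite -mulr_sumr => /eqP; rewrite mulf_eq0 pnatr_eq0 /= => /eqP.
Qed.

Lemma NA' b x : U x -> \sum_a N a x * A a b x = 0.
Proof. by move=> Ux; rewrite (eq_bigr (fun a => N a x * A b a x)) ?NA // => a _; rewrite (AC a b Ux). Qed.

Lemma NA2 b x : U x -> \sum_a N a x * A2 a b x = 0.
Proof.
move=> Ux; under eq_bigr do rewrite mulr_sumr.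
rewrite exchange_big big1 // => d _.
by under eq_bigr do rewrite mulrA; rewrite -mulr_suml NA' // mul0r.
Qed.

Lemma Ndl f x : U x -> \sum_a N a x * dl a f x = 0.
Proof.
move=> Ux; under eq_bigr do rewrite dlE mulr_sumr.
rewrite exchange_big big1 // => j _.
by under eq_bigr do rewrite mulrA; rewrite -mulr_suml NT // mul0r.
Qed.

(** The commutator is a vector field [Z]. Its action on the components of the immersion follows from
    [dX], and this action determines [Z] because [T] is dual to the Jacobian by [TX]. *)
Lemma dl_comm a b f x : sm U f -> U x ->
  dl a (dl b f) x - dl b (dl a f) x =
  \sum_c (N a x * A b c x - N b x * A a c x) * dl c f x.
Proof.
move=> F Ux; pose Z j := dl a (T b j) x - dl b (T a j) x.
have ZX c : \sum_j Z j * 'D_(e j) (X c) x = N a x * A b c x - N b x * A a c x.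
  rewrite -dl_comm_raw //.
  have H a' b' : dl a' (dl b' (X c)) x = - (A a' b' x * N c x + N b' x * A a' c x).
    rewrite (dl_ext _ Ux (fun y Uy => dX b' c Uy)) dl_sub //; last first.
    - exact: sm_mul.
    - exact: sm_cst.
    by rewrite dl_cst dl_mul // sub0r.
  by rewrite !H (AC b a Ux); ring.
have ZE j : Z j = \sum_c T c j x * (N a x * A b c x - N b x * A a c x).
  under eq_bigr do rewrite -ZX mulr_sumr.
  rewrite exchange_big (bigD1 j) //= [X in _ + X]big1 ?addr0.
    under eq_bigr do rewrite mulrCA.
    by rewrite -mulr_sumr TX // eqxx mulr1.
  move=> i ij; under eq_bigr do rewrite mulrCA.
  by rewrite -mulr_sumr TX // eq_sym (negbTE ij) mulr0.
rewrite dl_comm_raw //; under eq_bigr do rewrite -/(Z _) ZE mulr_suml.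
rewrite exchange_big; apply: eq_bigr => c _; rewrite dlE mulr_sumr.
by apply: eq_bigr => j _; ring.
Qed.

(* Codazzi equation; the two quadratic terms come from the extension of A by zero
   in the normal direction. *)
Lemma codazzi c a b x : U x ->
  dl c (A a b) x = dl a (A c b) x + N c x * A2 a b x - N a x * A2 c b x.
Proof.
move=> Ux; have := dl_comm c a (smN b) Ux.
rewrite -/(A a b) -/(A c b) => /(canRL (subrK _)) ->.
rewrite [RHS]addrAC -[RHS]addrA addrC; congr (_ + _).
rewrite /A2 !mulr_sumr addrC -sumrB; apply: eq_bigr => d _; rewrite -/(A d b).
by ring.
Qed.

(** Contracted Codazzi equation. The term along [N] is the normal component of the divergence of the
    extension by zero. *)
Lemma divA b x : U x -> \sum_c dl c (A c b) x = dl b trA x - N b x * sA x.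
Proof.
move=> Ux.
rewrite (eq_bigr (fun c => dl b (A c c) x + N c x * A2 b c x - N b x * A2 c c x)); last first.
  move=> c _; rewrite -(codazzi c b c Ux); exact: (dl_ext c Ux (fun y Uy => AC c b Uy)).
rewrite sumrB big_split /= -mulr_sumr -(dl_sum b (fun c => smA c c) Ux).
rewrite (_ : \sum_c N c x * A2 b c x = 0); last first.
  by rewrite (eq_bigr (fun c => N c x * A2 c b x)) ?NA2 // => c _; rewrite (A2C b c Ux).
rewrite addr0; congr (_ - _ * _); apply: eq_bigr => c _.
by apply: eq_bigr => d _; rewrite (AC d c Ux).
Qed.

(** Derivative of the relation [NA']: although [A] has no normal component, its derivative has
    one. *)
Lemma Ndl_A d b x : U x -> \sum_c N c x * dl d (A c b) x = - A2 d b x.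
Proof.
move=> Ux; have : dl d (fun y => \sum_c N c y * A c b y) x = 0.
  by rewrite (dl_ext d Ux (fun y Uy => NA' b Uy)) dl_cst.
rewrite dl_sum //; last by move=> c; apply: sm_mul => //; exact: smA.
rewrite (eq_bigr (fun c => A d c x * A c b x + N c x * dl d (A c b) x)); last first.
  by move=> c _; rewrite (dl_mul d (smN c) (smA c b) Ux).
rewrite big_split /= => /eqP; rewrite addrC addr_eq0 => /eqP ->.
by congr (- _).
Qed.

Lemma dl_sA c y : U y -> dl c sA y = \sum_a \sum_b 2 * (A a b y * dl c (A a b) y).
Proof.
move=> Uy; have sm2 a b : sm U (fun y => A a b y * A a b y) by exact: (smM (smA a b) (smA a b)).
have sm3 a : sm U (fun y => \sum_b A a b y * A a b y) by exact: sm_sum.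
rewrite (dl_sum c sm3 Uy); apply: eq_bigr => a _.
rewrite (dl_sum c (sm2 a) Uy); apply: eq_bigr => b _.
by rewrite (dl_mul c (smA a b) (smA a b) Uy); ring.
Qed.

Section Minimal.
Hypothesis tr0 : forall x, U x -> trA x = 0.

(** The Codazzi equation turns delta_c A_ab into delta_a A_cb; after commuting delta_c with delta_a,
    the divergence of A appears and [divA] applies with trace zero. The terms carrying a factor
    [N a] or [N b] disappear when contracted with A. *)
Lemma lapA a b x : U x ->
  \sum_c dl c (dl c (A a b)) x =
  - (A a b x * sA x) - 2 * (\sum_d A a d x * A2 d b x) - N b x * dl a sA x
  - N a x * (\sum_c \sum_d A c d x * dl d (A c b) x + \sum_c dl c (A2 c b) x).
Proof.
move=> Ux.
have E1 c : dl c (dl c (A a b)) x = (dl a (dl c (A c b)) x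
      + \sum_d (N c x * A a d x - N a x * A c d x) * dl d (A c b) x)
    + (A c c x * A2 a b x + N c x * dl c (A2 a b) x)
    - (A c a x * A2 c b x + N a x * dl c (A2 c b) x).
  rewrite (dl_ext c Ux (fun y Uy => codazzi c a b Uy)).
  rewrite (dl_sub c (smD (sm_dl a (smA c b)) (smM (smN c) (smA2 a b)))
     (smM (smN a) (smA2 c b)) Ux).
  rewrite (dl_add c (sm_dl a (smA c b)) (smM (smN c) (smA2 a b)) Ux).
  rewrite (dl_mul c (smN c) (smA2 a b) Ux) (dl_mul c (smN a) (smA2 c b) Ux).
  by congr (_ + _ - _); rewrite -(dl_comm c a (smA c b) Ux) [RHS]addrC subrK.
under eq_bigr do rewrite E1.
rewrite sumrB !big_split /=.
have -> : \sum_c dl a (dl c (A c b)) x = - (A a b x * sA x) - N b x * dl a sA x.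
  rewrite -dl_sum //; last by move=> c; exact: (sm_dl c (smA c b)).
  have H y : U y -> \sum_c dl c (A c b) y = - (N b y * sA y).
    move=> Uy; rewrite divA // (dl_ext b Uy tr0) dl_cst sub0r //.
  rewrite (dl_ext a Ux H) (dl_opp a (smM (smN b) sm_sA) Ux).
  by rewrite (dl_mul a (smN b) sm_sA Ux) opprD.
have -> : \sum_c \sum_d (N c x * A a d x - N a x * A c d x) * dl d (A c b) x =
   - (\sum_d A a d x * A2 d b x) - N a x * \sum_c \sum_d A c d x * dl d (A c b) x.
  under eq_bigr => c _ do (under eq_bigr do rewrite mulrBl; rewrite sumrB).
  rewrite sumrB; congr (_ - _).
    rewrite exchange_big -sumrN; apply: eq_bigr => d _ /=.
    rewrite -mulrN -Ndl_A // mulr_sumr; apply: eq_bigr => c _; ring.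
  rewrite mulr_sumr; apply: eq_bigr => c _; rewrite mulr_sumr.
  by apply: eq_bigr => d _; ring.
have -> : \sum_c A c c x * A2 a b x = 0.
  by rewrite -mulr_suml -/(trA x) tr0 // mul0r.
rewrite Ndl // -mulr_sumr.
have -> : \sum_c A c a x * A2 c b x = \sum_d A a d x * A2 d b x.
  by apply: eq_bigr => c _; rewrite (AC c a Ux).
by ring.
Qed.

(* t4 = tr A^4, qA = |delta A|^2, and gA = |nabla A|^2: the terms added in gA
   remove the normal components of delta_c A_ab. *)
Definition t4 x := \sum_a \sum_b A2 a b x * A2 a b x.
Definition qA x := \sum_c \sum_a \sum_b dl c (A a b) x * dl c (A a b) x.
Definition gA x := \sum_c \sum_a \sum_b
  (dl c (A a b) x + N a x * A2 c b x + N b x * A2 c a x) ^+ 2.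

Lemma contr_lapA x : U x ->
  \sum_a \sum_b A a b x * \sum_c dl c (dl c (A a b)) x = - sA x ^+ 2 - 2 * t4 x.
Proof.
move=> Ux.
pose h b := \sum_c \sum_d A c d x * dl d (A c b) x + \sum_c dl c (A2 c b) x.
rewrite (eq_bigr (fun a => \sum_b (- sA x * (A a b x * A a b x)
   - 2 * (\sum_d A a b x * (A a d x * A2 d b x)) - dl a sA x * (N b x * A a b x)
   - h b * (N a x * A a b x)))); last first.
  move=> a _; apply: eq_bigr => b _; rewrite lapA // -/(h b) -mulr_sumr; ring.
under eq_bigr do rewrite !sumrB.
rewrite !sumrB.
have -> : \sum_i \sum_j h j * (N i x * A i j x) = 0.
  by rewrite exchange_big big1 // => b _; rewrite -mulr_sumr NA' // mulr0.
have -> : \sum_i \sum_j dl i sA x * (N j x * A i j x) = 0.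
  by rewrite big1 // => a _; rewrite -mulr_sumr NA // mulr0.
have -> : \sum_i \sum_j - sA x * (A i j x * A i j x) = - sA x ^+ 2.
  by under eq_bigr do rewrite -mulr_sumr; rewrite -mulr_sumr -/(sA x) mulNr expr2.
rewrite !subr0; congr (_ - _).
under eq_bigr do rewrite -mulr_sumr.
rewrite -mulr_sumr; congr (_ * _).
rewrite exchange_big [RHS]exchange_big; apply: eq_bigr => b _ /=.
rewrite exchange_big; apply: eq_bigr => d _ /=.
rewrite {2}/A2 mulr_suml; apply: eq_bigr => a _.
by rewrite (AC a d Ux); ring.
Qed.

(** Simons' identity: by [gA_eq] the right-hand side equals 2 |nabla A|^2 - 2 |A|^4, the term [t4]
    being the normal part of |delta A|^2. *)
Lemma lap_sA x : U x ->
  \sum_c dl c (dl c sA) x = 2 * qA x - 2 * sA x ^+ 2 - 4 * t4 x.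
Proof.
move=> Ux.
have H c y : U y -> dl c sA y = \sum_a \sum_b 2 * (A a b y * dl c (A a b) y).
  exact: dl_sA.
have sm4 c a b : sm U (fun y => A a b y * dl c (A a b) y).
  by exact: (smM (smA a b) (sm_dl c (smA a b))).
have sm4' c a b : sm U (fun y => 2 * (A a b y * dl c (A a b) y)).
  by exact: (smM (sm_cst oU 2) (sm4 c a b)).
have sm5 c a : sm U (fun y => \sum_b 2 * (A a b y * dl c (A a b) y)) by exact: sm_sum.
have H2 c : dl c (dl c sA) x = \sum_a \sum_b (2 * (dl c (A a b) x * dl c (A a b) x)
      + 2 * (A a b x * dl c (dl c (A a b)) x)).
  rewrite (dl_ext c Ux (H c)) (dl_sum c (sm5 c) Ux); apply: eq_bigr => a _.
  rewrite (dl_sum c (sm4' c a) Ux); apply: eq_bigr => b _.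
  rewrite (dl_scale c 2 (sm4 c a b) Ux).
  rewrite (dl_mul c (smA a b) (sm_dl c (smA a b)) Ux); exact: mulrDr.
under eq_bigr do rewrite H2.
rewrite (sum3_split 2 2 (fun c a b => dl c (A a b) x * dl c (A a b) x)
  (fun c a b => A a b x * dl c (dl c (A a b)) x)) -/(qA x).
rewrite [X in _ + 2 * X](_ : _ = - sA x ^+ 2 - 2 * t4 x); first by ring.
rewrite -contr_lapA // exchange_big; apply: eq_bigr => a _ /=.
by rewrite exchange_big; apply: eq_bigr => b _; rewrite mulr_sumr.
Qed.

End Minimal.

Lemma gA_eq x : U x -> gA x = qA x - 2 * t4 x.
Proof.
move=> Ux; rewrite /gA /qA /t4 mulr_sumr -sumrB; apply: eq_bigr => c _.
have H1 b : \sum_a N a x * dl c (A a b) x = - A2 c b x by exact: Ndl_A.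
have H2 a : \sum_b N b x * dl c (A a b) x = - A2 c a x.
  apply: (etrans _ (Ndl_A c a Ux)); apply: eq_bigr => b _.
  by rewrite (dl_ext c Ux (fun y Uy => AC a b Uy)).
have H3 : \sum_a N a x * A2 c a x = 0.
  by rewrite (eq_bigr (fun a => N a x * A2 a c x)) ?NA2 // => a _; rewrite (A2C c a Ux).
have N1x := N1 Ux.
exact: sum_sqr_normal_part.
Qed.

(** The derivative delta_c s is 2 <A, nabla_c A>, since the terms that correct delta_c A to nabla_c
    A are orthogonal to A; the bound is then Cauchy-Schwarz for each c. *)
Lemma grad_sA_le x : U x -> \sum_c dl c sA x ^+ 2 <= 4 * sA x * gA x.
Proof.
move=> Ux; rewrite /gA mulr_sumr; apply: ler_sum => c _.
pose r a b := dl c (A a b) x + N a x * A2 c b x + N b x * A2 c a x.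
have -> : dl c sA x = 2 * \sum_a \sum_b A a b x * r a b.
  rewrite dl_sA // mulr_sumr; apply/eqP; rewrite -subr_eq0 -sumrB.
  rewrite (eq_bigr (fun a => \sum_b (- 2 * A2 c b x * (N a x * A a b x) +
      - 2 * A2 c a x * (N b x * A a b x)))); last first.
    move=> a _; rewrite mulr_sumr -sumrB; apply: eq_bigr => b _; rewrite /r.
    have aux (k q na nb u v : R) : 2 * (k * q) - 2 * (k * (q + na * u + nb * v)) =
      - 2 * u * (na * k) + - 2 * v * (nb * k) by ring.
    exact: aux.
  under eq_bigr do rewrite big_split /=.
  rewrite big_split /= [X in X + _]exchange_big /=.
  rewrite big1 ?add0r; last by move=> b _; rewrite -mulr_sumr NA' // mulr0.
  by rewrite big1 // => a _; rewrite -mulr_sumr NA // mulr0.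
have := @cauchy_schwarz_sum R _ (fun ab : I * I => A ab.1 ab.2 x) (fun ab => r ab.1 ab.2).
rewrite -(pair_bigA _ (fun a b => A a b x * r a b)) /=.
rewrite -(pair_bigA _ (fun a b => A a b x ^+ 2)) /=.
rewrite -(pair_bigA _ (fun a b => r a b ^+ 2)) /=.
rewrite (_ : \sum_a \sum_b A a b x ^+ 2 = sA x); last by [].
rewrite -/(r _ _); set S := \sum_i _; set Q := \sum_i _.
move=> H; rewrite exprMn -[4 * _ * _]mulrA.
by rewrite (_ : 2 ^+ 2 = 4) ?ler_pM2l //; ring.
Qed.

Lemma gA_ge0 x : 0 <= gA x.
Proof.
by apply: sumr_ge0 => c _; apply: sumr_ge0 => a _; apply: sumr_ge0 => b _; exact: sqr_ge0.
Qed.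

Lemma sA_ge0 x : 0 <= sA x.
Proof.
by apply: sumr_ge0 => a _; apply: sumr_ge0 => b _; rewrite -expr2; exact: sqr_ge0.
Qed.

(** The squared length of the immersion and, as [wX], its support function. *)
Definition qX : E -> R := fun x => \sum_a X a x * X a x.
Definition wX : E -> R := fun x => \sum_a X a x * N a x.

Lemma sm_qX : sm U qX. Proof. by apply: sm_sum => // a _; exact: smM. Qed.
Lemma sm_wX : sm U wX. Proof. by apply: sm_sum => // a _; exact: smM. Qed.

Lemma dl_qX c x : U x -> dl c qX x = 2 * (X c x - wX x * N c x).
Proof.
move=> Ux; rewrite (dl_sum c (fun a => smM (smX a) (smX a)) Ux).
rewrite (eq_bigr (fun a => 2 * ((c == a)%:R * X a x) - 2 * (N c x) * (X a x * N a x))).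
  rewrite sumrB -!mulr_sumr (bigD1 c) //= eqxx mul1r big1 ?addr0.
    by rewrite -/(wX x); ring.
  by move=> a ac; rewrite eq_sym (negbTE ac) mul0r.
by move=> a _; rewrite (dl_mul c (smX a) (smX a) Ux) dX //; ring.
Qed.

Lemma dl_wX c x : U x -> dl c wX x = \sum_a X a x * A c a x.
Proof.
move=> Ux; rewrite (dl_sum c (fun a => smM (smX a) (smN a)) Ux).
rewrite (eq_bigr (fun a => ((c == a)%:R * N a x - N c x * (N a x * N a x)) + X a x * A c a x)).
  rewrite big_split /= sumrB -mulr_sumr N1 // mulr1 (bigD1 c) //= eqxx mul1r big1 ?addr0.
    by rewrite subrr add0r.
  by move=> a ac; rewrite eq_sym (negbTE ac) mul0r.
by move=> a _; rewrite (dl_mul c (smX a) (smN a) Ux) dX // -/(A c a); ring.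
Qed.

Lemma sum_proj x : U x -> \sum_(c < n.+1) (1 - N c x * N c x) = n%:R.
Proof. by move=> Ux; rewrite sumrB N1 // sumr_const card_ord mulrSr addrK. Qed.

(** Half the gradient of |X|^2 is the tangential part X - wX N, whose divergence is n - wX tr A. *)
Lemma lap_qX x : U x -> trA x = 0 -> \sum_c dl c (dl c qX) x = 2 * n%:R.
Proof.
move=> Ux tr0; rewrite (eq_bigr (fun c => 2 * ((1 - N c x * N c x) - (N c x * dl c wX x) - wX x * A c c x))).
  by rewrite -mulr_sumr !sumrB Ndl // subr0 -mulr_sumr -/(trA x) tr0 mulr0 subr0 -sumrB sum_proj.
move=> c _; rewrite (dl_ext c Ux (@dl_qX c)).
rewrite (dl_scale c 2 (sm_sub_fun oU (smX c) (smM sm_wX (smN c))) Ux).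
rewrite (dl_sub c (smX c) (smM sm_wX (smN c)) Ux) (dl_mul c sm_wX (smN c) Ux) dX // eqxx -[true%:R]/(1 : R) -/(A c c).
by ring.
Qed.

Lemma lap_test (k1 k2 k3 : R) x : U x -> trA x = 0 ->
  \sum_c dl c (dl c (fun y => k1 * sA y + k2 * (sA y * sA y) + k3 * qX y)) x =
  (k1 + 2 * k2 * sA x) * (\sum_c dl c (dl c sA) x) + 2 * k2 * (\sum_c dl c sA x ^+ 2)
  + 2 * n%:R * k3.
Proof.
move=> Ux tr0; rewrite -(lap_qX Ux tr0).
have smSS : sm U (fun y => sA y * sA y) by exact: (smM sm_sA sm_sA).
have smk (k : R) f : sm U f -> sm U (fun y => k * f y) by move=> F; exact: (smM (sm_cst oU k) F).
have H c y : U y -> dl c (fun y => k1 * sA y + k2 * (sA y * sA y) + k3 * qX y) y =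
    k1 * dl c sA y + (2 * k2) * (sA y * dl c sA y) + k3 * dl c qX y.
  move=> Uy; rewrite (dl_add c (smD (smk k1 _ sm_sA) (smk k2 _ smSS)) (smk k3 _ sm_qX) Uy).
  rewrite (dl_add c (smk k1 _ sm_sA) (smk k2 _ smSS) Uy).
  rewrite (dl_scale c k1 sm_sA Uy) (dl_scale c k2 smSS Uy) (dl_scale c k3 sm_qX Uy).
  by rewrite (dl_mul c sm_sA sm_sA Uy); ring.
rewrite (eq_bigr (fun c => (k1 + 2 * k2 * sA x) * dl c (dl c sA) x +
   2 * k2 * dl c sA x ^+ 2 + dl c (dl c qX) x * k3)).
  by rewrite !big_split /= -!mulr_sumr -mulr_suml.
move=> c _; rewrite (dl_ext c Ux (H c)).
have s1 := smk k1 _ (sm_dl c sm_sA).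
have s2 : sm U (fun y => sA y * dl c sA y) by exact: (smM sm_sA (sm_dl c sm_sA)).
have s3 := smk k3 _ (sm_dl c sm_qX).
rewrite (dl_add c (smD s1 (smk (2 * k2) _ s2)) s3 Ux) (dl_add c s1 (smk (2 * k2) _ s2) Ux).
rewrite (dl_scale c k1 (sm_dl c sm_sA) Ux) (dl_scale c (2 * k2) s2 Ux) (dl_scale c k3 (sm_dl c sm_qX) Ux).
rewrite (dl_mul c sm_sA (sm_dl c sm_sA) Ux).
have aux (a b d e f g : R) : k1 * a + 2 * k2 * (b * b + d * a) + k3 * e =
   (k1 + 2 * k2 * d) * a + 2 * k2 * b ^+ 2 + e * k3 by ring.
exact: aux.
Qed.

(** Insert Simons' identity and bound |grad s|^2 by 4 s |nabla A|^2. The total coefficient of |nabla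
    A|^2 is then (1 - eps s) - 2 eps s, nonnegative by assumption. *)
Lemma lap_test_ge (eps al : R) x : (forall y, U y -> trA y = 0) -> U x ->
  0 <= eps -> 3 * eps * sA x <= 1 ->
  al * n%:R - (1 - eps * sA x) * sA x ^+ 2 <=
  \sum_c dl c (dl c (fun y => 2^-1 * sA y + (- eps / 4) * (sA y * sA y) + (al / 2) * qX y)) x.
Proof.
move=> tr0 Ux e0 e1; rewrite lap_test //; last exact: tr0.
rewrite lap_sA //.
have := grad_sA_le Ux; have := gA_eq Ux; have := gA_ge0 x; have := sA_ge0 x.
move: (sA x) (gA x) (qA x) (t4 x) (\sum_c _) e1 => s G q t D e1 s0 G0 EG DG.
rewrite EG in G0 DG.
have H1 : 0 <= (1 - 3 * eps * s) * (q - 2 * t) by rewrite mulr_ge0 // subr_ge0.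
have H2 : eps * D <= eps * (4 * s * (q - 2 * t)) by rewrite ler_wpM2l.
rewrite -subr_ge0.
rewrite (_ : _ - _ = ((1 - 3 * eps * s) * (q - 2 * t) + 2^-1 * (eps * (4 * s * (q - 2 * t)) - eps * D))); last by field.
by rewrite addr_ge0 // mulr_ge0 // subr_ge0.
Qed.

(** The gradient vanishes at the maximum, so the derivatives of the coefficients T drop out and each
    summand is a second derivative along the fixed vector [w]. *)
Lemma max_lap_le0 f x : sm U f -> U x -> (\forall y \near x, f y <= f x) ->
  \sum_c dl c (dl c f) x <= 0.
Proof.
move=> F Ux fmax; apply: sumr_le0 => c _.
have D0 v : 'D_v f x = 0 by apply: derive_max_eq0 => //; exact: sm_derivable F Ux.
pose w : E := \row_j T c j x.
have -> : dl c (dl c f) x = 'D_w ('D_w f) x.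
  have H y : U y -> 'D_w f y = \sum_j T c j x * 'D_(e j) f y.
    move=> Uy; rewrite (sm_deriveE _ oU F Uy); apply: eq_bigr => j _.
    by rewrite mxE.
  rewrite (dl_ext c Ux (fun y _ => dlE c f y)).
  rewrite (dl_sum c (fun j => smM (smT c j) (sm_derive (e j) F)) Ux).
  rewrite (sm_deriveE _ oU (sm_derive w F) Ux).
  under [RHS]eq_bigr => i _.
    rewrite (derive_eqU oU (e i) Ux H) mxE.
    have [|_ ->] := @is_deriveSf R E _ (index_enum _) xpredT (fun j y => T c j x * 'D_(e j) f y) x (e i) (fun j => T c j x * 'D_(e i) ('D_(e j) f) x).
      move=> j _.
      have := is_deriveMf (is_derive_cst (T c j x) x (e i)) (sm_is_derive (e i) (sm_derive (e j) F) Ux).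
      by rewrite mul0r add0r.
    over.
  rewrite /=.
  under [RHS]eq_bigr do rewrite mulr_sumr.
  rewrite [RHS]exchange_big; apply: eq_bigr => j _ /=.
  rewrite (dl_mul c (smT c j) (sm_derive (e j) F) Ux) D0 mulr0 add0r dlE mulr_sumr.
  by apply: eq_bigr => i _; rewrite mulrCA.
apply: derive2_max_le0 => //.
  have : nbhs x U by exact: open_nbhs_nbhs.
  by apply: nearS2 (filterT : nbhs x setT) => y _ Uy; exact: sm_derivable F Uy.
exact: sm_derivable (sm_derive w F) Ux.
Qed.

(** * Free boundary points *)

Section Boundary.
Hypothesis sph1 : forall y, U y -> dot y y = 1 -> qX y = 1.
Hypothesis sphw : forall y, U y -> dot y y = 1 -> wX y = 0.

(** The vector v - <v, y> y is tangent to the sphere of the domain, so [derive_tangent] removes its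
    contribution. *)
Lemma derive_radial f y v : sm U f -> U y -> dot y y = 1 ->
  (forall z, U z -> dot z z = 1 -> f z = 0) -> 'D_v f y = dot v y * 'D_y f y.
Proof.
move=> F Uy yy fz; have := @derive_tangent R n U f y (v + (- dot v y) *: y) oU F Uy yy.
rewrite dotDl dotZl yy mulr1 subrr => /(_ erefl fz).
rewrite !(sm_deriveE _ oU F Uy) => /eqP.
under eq_bigr do rewrite !mxE mulrDl -mulrA.
by rewrite big_split /= -mulr_sumr mulNr subr_eq0 => /eqP.
Qed.

(** The vector J^T g^-1 y: the direction in the ambient space of the tangential gradient of any
    function that vanishes on the sphere of the domain, hence a conormal. *)
Definition tau y a : R := \sum_j T a j y * y 0 j.

Lemma dl_radial f a y : sm U f -> U y -> dot y y = 1 ->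
  (forall z, U z -> dot z z = 1 -> f z = 0) -> dl a f y = 'D_y f y * tau y a.
Proof.
move=> F Uy yy fz; rewrite dlE /tau mulr_sumr; apply: eq_bigr => j _.
rewrite (derive_radial (e j) F Uy yy fz).
have -> : dot (e j) y = y 0 j.
  rewrite /dot (bigD1 j) //= mxE !eqxx mul1r big1 ?addr0 // => i ij.
  by rewrite mxE (negbTE ij) andbF mul0r.
by ring.
Qed.

(** The function |X|^2 - 1 vanishes on the sphere, and its gradient there is 2 X because the support
    function is zero. Thus X itself is conormal. *)
Lemma X_radial a y : U y -> dot y y = 1 -> 2 * X a y = 'D_y qX y * tau y a.
Proof.
move=> Uy yy.
have s1 : sm U (fun z => qX z - 1) by apply: sm_sub_fun => //; [exact: sm_qX|exact: sm_cst].
have := @dl_radial (fun z => qX z - 1) a y s1 Uy yy.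
have -> : 'D_y (fun z => qX z - 1) y = 'D_y qX y.
  by have [_ ->] := is_deriveBf (sm_is_derive y sm_qX Uy) (is_derive_cst (1:R) y y); rewrite subr0.
rewrite (dl_sub a sm_qX (sm_cst oU 1) Uy) dl_cst subr0 dl_qX // sphw // mul0r subr0; apply.
by move=> z Uz zz; rewrite sph1 // subrr.
Qed.

Lemma X_tau y : U y -> dot y y = 1 -> 'D_y qX y * \sum_a X a y * tau y a = 2.
Proof.
move=> Uy yy; transitivity (2 * qX y); last by rewrite sph1 // mulr1.
rewrite !mulr_sumr; apply: eq_bigr => a _.
by rewrite mulrCA -X_radial // mulrCA.
Qed.

(** The gradient is a multiple of [tau], hence of the unit vector X, and its coefficient is found by
    pairing with X. *)
Lemma dl_normal f a y : sm U f -> U y -> dot y y = 1 ->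
  (forall z, U z -> dot z z = 1 -> f z = 0) ->
  dl a f y = (\sum_b X b y * dl b f y) * X a y.
Proof.
move=> F Uy yy fz; rewrite (dl_radial a F Uy yy fz).
under eq_bigr do rewrite (dl_radial _ F Uy yy fz) mulrCA.
rewrite -mulr_sumr.
have H := X_tau Uy yy; have Ha := X_radial a Uy yy.
have -> : X a y = 'D_y qX y * tau y a / 2 by rewrite -Ha; field.
by rewrite [in LHS](_ : tau y a = ('D_y qX y * \sum_a X a y * tau y a) * tau y a / 2); [ring|rewrite H; field].
Qed.

(** Pull-back to the domain of the tangential part of X; at free boundary points this part is X
    itself. *)
Definition vF y : E := \row_j \sum_a X a y * T a j y.

Lemma derive_vF f y : sm U f -> U y -> 'D_(vF y) f y = \sum_a X a y * dl a f y.
Proof.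
move=> F Uy; rewrite (sm_deriveE _ oU F Uy).
under eq_bigr do rewrite mxE mulr_suml.
under [RHS]eq_bigr do rewrite dlE mulr_sumr.
by rewrite exchange_big; apply: eq_bigr => a _; apply: eq_bigr => j _; rewrite mulrA.
Qed.

(** By [X_tau] the product of the radial derivative of |X|^2 with this scalar product is 2, so the
    radial derivative is nonzero and a weak sign for it suffices. *)
Lemma vF_outward y : U y -> dot y y = 1 -> 0 <= 'D_y qX y -> 0 < dot (vF y) y.
Proof.
move=> Uy yy q0.
have -> : dot (vF y) y = \sum_a X a y * tau y a.
  rewrite /dot; under eq_bigr do rewrite mxE mulr_suml.
  rewrite exchange_big; apply: eq_bigr => a _; rewrite mulr_sumr.
  by apply: eq_bigr => j _; rewrite mulrA.
have H := X_tau Uy yy.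
have : 0 < 'D_y qX y * \sum_a X a y * tau y a by rewrite H.
by rewrite pmulr_rgt0 // lt_neqAle q0 andbT; apply/eqP => q00; move/eqP: H; rewrite -q00 mul0r eq_sym pnatr_eq0.
Qed.

Definition AX b : E -> R := fun y => \sum_c X c y * A b c y.
Definition kap : E -> R := fun y => \sum_b X b y * AX b y.
Lemma sm_AX b : sm U (AX b). Proof. by apply: sm_sum => // c _; exact: (smM (smX c) (smA b c)). Qed.
Lemma sm_kap : sm U kap. Proof. by apply: sm_sum => // b _; exact: (smM (smX b) (sm_AX b)). Qed.

(* The gradient A X of the support function <X, N> is normal to the boundary:
   X is a principal direction. *)
Lemma AX_bd b y : U y -> dot y y = 1 -> AX b y = kap y * X b y.
Proof.
move=> Uy yy; have := dl_normal b sm_wX Uy yy sphw.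
have -> : \sum_c X c y * dl c wX y = kap y.
  by apply: eq_bigr => c _; rewrite dl_wX.
by rewrite dl_wX.
Qed.

Variable p : E.
Hypotheses (Up : U p) (pp : dot p p = 1).
(** U leaves the closed ball near a boundary point, and the trace may be nonzero outside; minimality
    is therefore stated at [p] and to first order in the direction X. *)
Hypotheses (trp : trA p = 0) (dtrp : \sum_a X a p * dl a trA p = 0).

(* Hessian of the support function at p. *)
Definition BB a b : R := dl a (AX b) p.

Lemma BB_A a b : BB a b = A a b p + \sum_c X c p * dl a (A b c) p.
Proof.
rewrite /BB (dl_sum a (fun c => smM (smX c) (smA b c)) Up).
rewrite (eq_bigr (fun c => ((a == c)%:R * A b c p - N a p * (N c p * A b c p)) + X c p * dl a (A b c) p)).
  rewrite big_split /= sumrB -mulr_sumr NA // mulr0 subr0 (bigD1 a) //= eqxx mul1r big1 ?addr0.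
    by rewrite (AC b a Up).
  by move=> c ac; rewrite eq_sym (negbTE ac) mul0r.
move=> c _; rewrite (dl_mul a (smX c) (smA b c) Up) dX //.
have aux (d na nc k z : R) : (d - na * nc) * k + z = d * k - na * (nc * k) + z by ring.
exact: aux.
Qed.

Definition rho b : R := \sum_c X c p * dl c (fun z => AX b z - kap z * X b z) p.

(** [AX b - kap * X b] vanishes on the boundary by [AX_bd], so its gradient is [rho b] times X. This
    gives the Hessian as two terms containing X plus [kap] times the tangential projection. *)
Lemma BB_E a b : BB a b = dl a kap p * X b p + kap p * ((a == b)%:R - N a p * N b p) + rho b * X a p.
Proof.
have s1 : sm U (fun z => AX b z - kap z * X b z).
  by apply: sm_sub_fun => //; [exact: sm_AX|exact: (smM sm_kap (smX b))].
have := @dl_normal _ a p s1 Up pp.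
rewrite {1}(dl_sub a (sm_AX b) (smM sm_kap (smX b)) Up) (dl_mul a sm_kap (smX b) Up) dX //.
rewrite -/(rho b) -/(BB a b) => <-; last first.
  by move=> z Uz zz; rewrite AX_bd // subrr.
by rewrite addrC subrK.
Qed.

(** The trace is the Laplacian of the support function, tr A + <X, grad tr A> - |A|^2 <X, N>, and
    each of the three terms is zero at [p]. *)
Lemma trBB : \sum_a BB a a = 0.
Proof.
under eq_bigr do rewrite BB_A.
rewrite big_split /= -/(trA p) trp add0r exchange_big /=.
under eq_bigr do rewrite -mulr_sumr divA // mulrBr mulrA.
by rewrite sumrB dtrp sub0r -mulr_suml -/(wX p) sphw // mul0r oppr0.
Qed.

Lemma kap_rho : \sum_a X a p * dl a kap p + \sum_a X a p * rho a = - (n%:R * kap p).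
Proof.
have := trBB; rewrite (eq_bigr (fun a => X a p * dl a kap p + kap p * (1 - N a p * N a p) + X a p * rho a)).
  rewrite !big_split /= -mulr_sumr sum_proj // => /eqP.
  by rewrite addrAC addr_eq0 => /eqP ->; rewrite mulrC.
by move=> a _; rewrite BB_E eqxx -[true%:R]/(1 : R); ring.
Qed.

(** X is an eigenvector of A with eigenvalue [kap], the projection contributes [kap] times tr A = 0,
    and [kap_rho] evaluates the two terms that remain. *)
Lemma A_BB : \sum_a \sum_b A a b p * BB a b = - (n%:R * kap p ^+ 2).
Proof.
have AXr a : \sum_b A a b p * X b p = kap p * X a p.
  by rewrite -AX_bd //; apply: eq_bigr => b _; rewrite mulrC.
have AXl b : \sum_a A a b p * X a p = kap p * X b p.
  by rewrite -AX_bd //; apply: eq_bigr => a _; rewrite (AC a b Up) mulrC.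
rewrite (eq_bigr (fun a => \sum_b (dl a kap p * (A a b p * X b p) + kap p * ((a == b)%:R * A a b p)
    - kap p * N a p * (N b p * A a b p) + rho b * (A a b p * X a p)))); last first.
  move=> a _; apply: eq_bigr => b _; rewrite BB_E.
  have aux (al g x d k na nb r y : R) : al * (g * x + k * (d - na * nb) + r * y) =
    g * (al * x) + k * (d * al) - k * na * (nb * al) + r * (al * y) by ring.
  exact: aux.
under eq_bigr do rewrite !big_split sumrN /=.
rewrite !big_split sumrN /=.
have -> : \sum_a \sum_b dl a kap p * (A a b p * X b p) = kap p * \sum_a X a p * dl a kap p.
  rewrite mulr_sumr; apply: eq_bigr => a _; rewrite -mulr_sumr AXr.
  by rewrite mulrC -mulrA.
have -> : \sum_a \sum_b kap p * ((a == b)%:R * A a b p) = 0.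
  rewrite (eq_bigr (fun a => kap p * A a a p)).
    by rewrite -mulr_sumr -/(trA p) trp mulr0.
  move=> a _; rewrite -mulr_sumr (bigD1 a) //= eqxx mul1r big1 ?addr0 // => b ab.
  by rewrite eq_sym (negbTE ab) mul0r.
have -> : \sum_a \sum_b kap p * N a p * (N b p * A a b p) = 0.
  by rewrite big1 // => a _; rewrite -mulr_sumr NA // mulr0.
have -> : \sum_a \sum_b rho b * (A a b p * X a p) = kap p * \sum_b X b p * rho b.
  rewrite exchange_big mulr_sumr; apply: eq_bigr => b _; rewrite -mulr_sumr AXl.
  by rewrite mulrC -mulrA.
by rewrite addr0 subr0 -mulrDr kap_rho mulrN mulrCA expr2.
Qed.

(** By [BB_A] and the Codazzi equation, the contraction of A with the Hessian of the support
    function is s + d_X s / 2. By [A_BB] it is also - n kap^2, hence d_X s = -2 s - 2 n kap^2. *)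
Lemma boundary_sA : \sum_c X c p * dl c sA p <= - (2 * sA p).
Proof.
have H : \sum_c X c p * dl c sA p = 2 * \sum_a \sum_b A a b p * (BB a b - A a b p).
  have E1 c a b : X c p * (2 * (A a b p * dl c (A a b) p)) =
      2 * (A a b p * (X c p * dl a (A b c) p)) + X c p * N c p * (2 * (A a b p * A2 a b p))
      - 2 * X c p * A2 c b p * (N a p * A a b p).
    rewrite codazzi // (dl_ext a Up (fun y Uy => AC c b Uy)).
    have aux (x al d nc u na v : R) : x * (2 * (al * (d + nc * u - na * v))) =
      2 * (al * (x * d)) + x * nc * (2 * (al * u)) - 2 * x * v * (na * al) by ring.
    exact: aux.
  have E2 c : X c p * dl c sA p = \sum_a \sum_b 2 * (A a b p * (X c p * dl a (A b c) p))
      + X c p * N c p * (\sum_a \sum_b 2 * (A a b p * A2 a b p)).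
    rewrite dl_sA // mulr_sumr; under eq_bigr do rewrite mulr_sumr.
    under eq_bigr => a _ do (under eq_bigr do rewrite E1; rewrite sumrB big_split /=).
    rewrite sumrB big_split /= [X in _ - X](_ : _ = 0) ?subr0.
      by rewrite [in RHS]mulr_sumr; under [X in _ = _ + X]eq_bigr do rewrite mulr_sumr.
    by rewrite exchange_big big1 // => b _; rewrite -mulr_sumr NA' // mulr0.
  under eq_bigr do rewrite E2.
  rewrite big_split /= -mulr_suml -/(wX p) sphw // mul0r addr0.
  rewrite exchange_big mulr_sumr; apply: eq_bigr => a _ /=.
  rewrite exchange_big mulr_sumr; apply: eq_bigr => b _ /=.
  by rewrite BB_A addrAC subrr add0r -!mulr_sumr.
rewrite H.
under eq_bigr do (under eq_bigr do rewrite mulrBr; rewrite sumrB).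
rewrite sumrB A_BB -/(sA p) mulrBr lerBlDr addNr mulrN oppr_le0.
by apply: mulr_ge0 => //; apply: mulr_ge0 => //; exact: sqr_ge0.
Qed.
End Boundary.
End Frame.

(** * Local frames of an immersion *)

Section SmoothMatrix.
Variables (R : realType) (n : nat) (U : set 'rV[R]_n).
Hypothesis oU : open U.

Lemma sm_det (m : nat) (M : 'rV[R]_n -> 'M[R]_m) :
  (forall i j, sm U (fun x => M x i j)) -> sm U (fun x => \det (M x)).
Proof.
move=> H; apply: sm_sum => // s _; apply: sm_mul => //; first exact: sm_cst.
exact: sm_prod.
Qed.

Lemma sm_adj (m : nat) (M : 'rV[R]_n -> 'M[R]_m) i j :
  (forall i j, sm U (fun x => M x i j)) -> sm U (fun x => (\adj (M x)) i j).
Proof.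
move=> H; apply: (sm_ext oU (f := fun x => (-1) ^+ (j + i) * \det (row' j (col' i (M x))))).
  by move=> y _; rewrite mxE.
apply: sm_mul => //; first exact: sm_cst.
apply: sm_det => k l; apply: (sm_ext oU _ (H (lift j k) (lift i l))).
by move=> y _; rewrite !mxE.
Qed.
End SmoothMatrix.

Section SmoothMaps.
Variables (R : realType) (n : nat) (F : 'rV[R]_n -> 'rV[R]_n.+1).
Hypothesis smF : smooth F.
Local Notation e j := (delta_mx 0 j : 'rV[R]_n).

Definition coordF (a : 'I_n.+1) : 'rV[R]_n -> R := fun x => F x 0 a.

(** Quantifying over the list of directions lets the induction on the order pass from [vs] to
    [v :: vs]. *)
Lemma smooth_sm a : sm setT (coordF a).
Proof.
suff H k (vs : seq 'rV[R]_n) : Ck k setT (fun x => Pilot.Defs.iterD vs F x 0 a) by move=> k; exact: (H k [::]).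
elim: k vs => [|k IH] vs; have [c d] := smF vs.
  split => // x _; apply: (@continuous_comp _ _ _ (Pilot.Defs.iterD vs F) (fun M : 'rV[R]_n.+1 => M 0 a)).
    exact: c.
  exact: coord_continuous.
split; first by move=> x Ux; exact: (Ck_cont (IH vs) Ux).
split; first by move=> x v _; have /derivable_mxP := d v x; exact.
move=> v; apply: (Ck_ext openT _ (IH (v :: vs))) => y _.
by rewrite /= derive_mx // mxE.
Qed.

Lemma dF_coord i x a : dF F i x 0 a = 'D_(e i) (coordF a) x.
Proof. by have [_ d] := smF [::]; rewrite /dF derive_mx ?mxE //; exact: d. Qed.

Lemma ddF_coord i j x a : ddF F i j x 0 a = 'D_(e i) ('D_(e j) (coordF a)) x.
Proof.
have [_ d] := smF [:: evec R j].
rewrite /ddF derive_mx ?mxE; last exact: d.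
by apply: (@derive_eqU R n setT openT) => // y _; rewrite -dF_coord.
Qed.

Lemma jacobianE x i a : Pilot.Defs.jacobian F x i a = 'D_(e i) (coordF a) x.
Proof. by rewrite mxE dF_coord. Qed.

Lemma metricE x : metric F x = Pilot.Defs.jacobian F x *m (Pilot.Defs.jacobian F x)^T.
Proof.
apply/matrixP => i j; rewrite !mxE /dot; apply: eq_bigr => k _.
by rewrite !mxE.
Qed.

Lemma sm_jacobian i a : sm setT (fun x => Pilot.Defs.jacobian F x i a).
Proof.
apply: (sm_ext openT _ (sm_derive (e i) (smooth_sm a))) => y _.
by rewrite jacobianE.
Qed.

Lemma sm_metric i j : sm setT (fun x => metric F x i j).
Proof.
apply: (sm_ext openT (f := fun x => \sum_k Pilot.Defs.jacobian F x i k * Pilot.Defs.jacobian F x j k)).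
  by move=> y _; rewrite metricE mxE; apply: eq_bigr => k _; rewrite [_^T _ _]mxE.
apply: (sm_sum openT) => k _; apply: (sm_mul openT); exact: sm_jacobian.
Qed.
End SmoothMaps.

(** * Linear algebra of a hypersurface frame *)

Section RealMatrix.
Variable R : realType.

Lemma row_dotE (m : nat) (u v : 'rV[R]_m) : u *m v^T = (dot u v)%:M.
Proof.
apply/matrixP => i j; rewrite !ord1 !mxE /dot eqxx mulr1n; apply: eq_bigr => k _.
by rewrite mxE.
Qed.

Lemma gram_unitmx (m n : nat) (J : 'M[R]_(m, n)) : row_free J -> J *m J^T \in unitmx.
Proof.
move=> Jf; rewrite -row_free_unit -kermx_eq0; apply/rowV0P => v /sub_kermxP vJ.
have : (v *m J) *m (v *m J)^T = 0 by rewrite trmx_mul !mulmxA -(mulmxA v) vJ mul0mx.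
rewrite row_dotE => /matrixP/(_ 0 0); rewrite !mxE eqxx mulr1n => /eqP.
rewrite dot_eq0 => /eqP vJ0; apply: (row_free_inj Jf).
by rewrite vJ0 mul0mx.
Qed.
End RealMatrix.

Section PointwiseFrame.
Variables (R : realType) (n : nat).
Variables (J : 'M[R]_(n, n.+1)) (nu : 'rV[R]_n.+1).
Hypothesis gu : J *m J^T \in unitmx.
Hypothesis nu1 : dot nu nu = 1.
Hypothesis nuJ : nu *m J^T = 0.
Local Notation g := (J *m J^T).
Local Notation T := (J^T *m invmx g).

Lemma gram_tr : g^T = g. Proof. by rewrite trmx_mul trmxK. Qed.
Lemma gramV_tr : (invmx g)^T = invmx g. Proof. by rewrite trmx_inv gram_tr. Qed.
Lemma mul_J_T : J *m T = 1%:M. Proof. by rewrite mulmxA mulmxV. Qed.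
Lemma mul_nu_T : nu *m T = 0. Proof. by rewrite mulmxA nuJ mul0mx. Qed.
Lemma mul_T_T : T^T *m T = invmx g.
Proof. by rewrite trmx_mul gramV_tr trmxK -mulmxA mul_J_T mulmx1. Qed.

(** The square matrix with rows [nu] and J has the right inverse made of the columns of [nu^T] and
    T; a right inverse of a square matrix is also a left inverse. *)
Lemma resolution : nu^T *m nu + T *m J = 1%:M.
Proof.
have H : col_mx nu J *m row_mx nu^T T = 1%:M :> 'M[R]_(1 + n).
  rewrite mul_col_row row_dotE nu1 mul_nu_T mul_J_T.
  have -> : J *m nu^T = 0 by rewrite -[J]trmxK -trmx_mul nuJ trmx0.
  by rewrite -scalar_mx_block.
by have := mulmx1C H; rewrite mul_row_col.
Qed.

Lemma resolution' : nu^T *m nu + J^T *m T^T = 1%:M.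
Proof. by rewrite -[RHS]trmx1 -resolution linearD /= !trmx_mul !trmxK. Qed.

Lemma normal_line (mu : 'rV[R]_n.+1) : mu *m J^T = 0 -> mu = dot mu nu *: nu.
Proof.
move=> muJ; rewrite -[LHS]mulmx1 -resolution' mulmxDr !mulmxA muJ mul0mx addr0.
by rewrite row_dotE mul_scalar_mx.
Qed.

(** The rows of [DN] stand for the derivatives of a unit normal: they are tangential, so
    Weingarten's equation, the second hypothesis, determines them. *)
Lemma shape_mx (DN : 'M[R]_(n, n.+1)) (H : 'M[R]_n) : DN *m nu^T = 0 -> DN *m J^T = - H ->
  T *m DN = - (T *m H *m T^T).
Proof.
move=> h1 h2; rewrite -[DN]mulmx1 -resolution' mulmxDr !mulmxA h1 mul0mx add0r h2.
by rewrite mulNmx mulmxN !mulmxA.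
Qed.

Lemma tr_shape (H : 'M[R]_n) : H^T = H ->
  \tr (T *m H *m T^T) = \sum_i \sum_j invmx g i j * H i j.
Proof.
move=> HT; rewrite mxtrace_mulC mulmxA mul_T_T /mxtrace.
apply: eq_bigr => i _; rewrite mxE; apply: eq_bigr => j _.
by rewrite -[in LHS]HT mxE.
Qed.

End PointwiseFrame.

Lemma exchange_big4 (R : realType) (n : nat) (t : 'I_n -> 'I_n -> 'I_n -> 'I_n -> R) :
  \sum_i \sum_j \sum_k \sum_l t i j k l = \sum_k \sum_l \sum_i \sum_j t i j k l.
Proof.
under eq_bigr do rewrite exchange_big /=.
rewrite exchange_big /=; apply: eq_bigr => k _.
by under eq_bigr do rewrite exchange_big /=; rewrite exchange_big.
Qed.

(** Both sides are tr (gi H gi H), by the cyclicity of the trace. *)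
Lemma sqr_shape (R : realType) (m n : nat) (T : 'M[R]_(m, n)) (H : 'M[R]_n) : H^T = H ->
  let gi := T^T *m T in let S := T *m H *m T^T in
  \sum_a \sum_b S a b * S a b =
  \sum_i \sum_j \sum_k \sum_l gi i k * gi j l * H i j * H k l.
Proof.
move=> HT gi S.
have ST : S^T = S by rewrite /S !trmx_mul trmxK HT mulmxA.
have giT : gi^T = gi by rewrite /gi trmx_mul trmxK.
have -> : \sum_a \sum_b S a b * S a b = \tr (S *m S).
  apply: eq_bigr => a _; rewrite mxE; apply: eq_bigr => b _; congr (_ * _).
  by rewrite -[in LHS]ST mxE.
have -> : \tr (S *m S) = \tr (gi *m H *m gi *m H).
  by rewrite [RHS]mxtrace_mulC /S -!mulmxA [LHS]mxtrace_mulC /gi !mulmxA.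
rewrite exchange_big4 /mxtrace; apply: eq_bigr => k _.
rewrite mxE; apply: eq_bigr => l _.
rewrite mxE mulr_suml [RHS]exchange_big; apply: eq_bigr => j _ /=.
rewrite mxE !mulr_suml; apply: eq_bigr => i _.
have -> : gi k i = gi i k by rewrite -[in LHS]giT mxE.
have -> : H l k = H k l by rewrite -[in LHS]HT mxE.
by ring.
Qed.

(* nu is only continuous on the closed ball, so it is replaced near each point by a
   smooth normal N on an open set U, equal to nu up to sign on the ball. *)
Record is_frame (R : realType) (n : nat) (F nu : 'rV[R]_n -> 'rV[R]_n.+1) (U : set 'rV[R]_n)
    (T : 'I_n.+1 -> 'I_n -> 'rV[R]_n -> R) (N : 'I_n.+1 -> 'rV[R]_n -> R) : Prop := {
  fr_open : open U;
  fr_smT : forall a j, sm U (T a j);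
  fr_smX : forall a, sm U (coordF F a);
  fr_smN : forall a, sm U (N a);
  fr_N1 : forall x, U x -> \sum_a N a x * N a x = 1;
  fr_NT : forall j x, U x -> \sum_a N a x * T a j x = 0;
  fr_TX : forall i j x, U x ->
    \sum_c T c i x * 'D_(delta_mx 0 j) (coordF F c) x = (i == j)%:R;
  fr_dX : forall a b x, U x -> dl T a (coordF F b) x = (a == b)%:R - N a x * N b x;
  fr_sym : forall a b x, U x -> dl T a (N b) x = dl T b (N a) x;
  fr_sA : forall x, U x -> cball x -> normA2 F nu x = sA T N x;
  fr_tr : forall x, U x -> cball x -> trA T N x = 0;
  fr_proj : forall a b x, U x ->
    ((Pilot.Defs.jacobian F x)^T *m metric_inv F x *m Pilot.Defs.jacobian F x) a b
    = (a == b)%:R - N a x * N b x;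
  fr_nu : forall x, U x -> cball x -> exists2 c : R, c ^+ 2 = 1 & forall a, nu x 0 a = c * N a x
}.

Section FrameExists.
Variables (R : realType) (n : nat) (F nu : 'rV[R]_n -> 'rV[R]_n.+1).
Hypothesis smF : smooth F.
Hypothesis immF : immersion_on F (@cball R n).
Hypothesis nuF : forall x, cball x -> dot (nu x) (nu x) = 1 /\ forall i, dot (nu x) (dF F i x) = 0.
Hypothesis minF : forall x, cball x -> mean_curv F nu x = 0.
Local Notation e j := (delta_mx 0 j : 'rV[R]_n).
Local Notation J x := (Pilot.Defs.jacobian F x).
Local Notation X := (coordF F).
Implicit Types x y : 'rV[R]_n.

Lemma mul_row_jacobian (v : 'rV[R]_n.+1) x i : (v *m (J x)^T) 0 i = dot v (dF F i x).
Proof. by rewrite mxE; apply: eq_bigr => k _; rewrite !mxE. Qed.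

Lemma nu_jacobian x : cball x -> nu x *m (J x)^T = 0.
Proof. by move=> /nuF [_ H]; apply/rowP => i; rewrite mul_row_jacobian H mxE. Qed.

Lemma metric_unit x : cball x -> metric F x \in unitmx.
Proof. by move=> /immF H; rewrite metricE //; exact: gram_unitmx. Qed.

Variable p : 'rV[R]_n.
Hypothesis Bp : cball p.

(* det g times the normal projection of nu p: with the adjugate instead of the
   inverse it is smooth everywhere. *)
Definition rawN x : 'rV[R]_n.+1 :=
  \det (metric F x) *: nu p - nu p *m (J x)^T *m \adj (metric F x) *m J x.
Definition rawN2 x : R := dot (rawN x) (rawN x).
(** One strict inequality encodes both an invertible metric and a nonzero projected normal. The
    square makes the sign of the determinant irrelevant; at [p] the value is the fourth power of the
    determinant. *)
Definition frU : set 'rV[R]_n :=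
  (fun x => \det (metric F x) ^+ 2 * rawN2 x) @^-1` [set t : R | 0 < t].
Definition frN (a : 'I_n.+1) x : R := rawN x 0 a * (Num.sqrt (rawN2 x))^-1.
Definition rowN x : 'rV[R]_n.+1 := (Num.sqrt (rawN2 x))^-1 *: rawN x.
Definition matT x : 'M[R]_(n.+1, n) := (J x)^T *m invmx (metric F x).
Definition frT a j x : R := matT x a j.

Lemma sm_rawN a : sm setT (fun x => rawN x 0 a).
Proof.
have oT := @openT 'rV[R]_n.
have sd := sm_det oT (sm_metric smF).
apply: (sm_ext oT (f := fun x => \det (metric F x) * nu p 0 a -
   \sum_i (\sum_j (\sum_k nu p 0 k * J x j k) * (\adj (metric F x)) j i) * J x i a)).
  move=> y _; rewrite !mxE; congr (_ - _); apply: eq_bigr => i _; congr (_ * _).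
  rewrite mxE; apply: eq_bigr => j _; congr (_ * _).
  by rewrite mxE; apply: eq_bigr => k _; rewrite [_^T _ _]mxE.
apply: sm_sub_fun => //; first by apply: (sm_mul oT sd); exact: sm_cst.
apply: (sm_sum oT) => i _; apply: (sm_mul oT); last exact: sm_jacobian.
apply: (sm_sum oT) => j _; apply: (sm_mul oT); last exact: (sm_adj oT _ _ (sm_metric smF)).
apply: (sm_sum oT) => k _; apply: (sm_mul oT); last exact: sm_jacobian.
exact: sm_cst.
Qed.

Lemma sm_rawN2 : sm setT rawN2.
Proof.
apply: (sm_sum (@openT _)) => k _; apply: (sm_mul (@openT _)); exact: sm_rawN.
Qed.

Lemma frU_open : open frU.
Proof.
have oT := @openT 'rV[R]_n.
apply: open_comp; last exact: open_gt.
move=> x _; apply: (@sm_cont R n setT (fun x => \det (metric F x) ^+ 2 * rawN2 x)) => //.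
apply: (sm_mul oT _ sm_rawN2).
have sd := sm_det oT (sm_metric smF).
exact: (sm_ext oT (fun y _ => esym (expr2 _)) (sm_mul oT sd sd)).
Qed.

Lemma frU_rawN2 x : frU x -> 0 < rawN2 x.
Proof.
rewrite /frU /= => H; rewrite lt_neqAle dot_ge0 andbT; apply/eqP => H0.
by move: H; rewrite -H0 mulr0 ltxx.
Qed.

Lemma frU_unit x : frU x -> metric F x \in unitmx.
Proof.
rewrite /frU /= => H; rewrite unitmxE unitfE; apply/eqP => H0.
by move: H; rewrite H0 expr0n mul0r ltxx.
Qed.

Lemma frU_gram x : frU x -> J x *m (J x)^T \in unitmx.
Proof. by move=> /frU_unit; rewrite metricE. Qed.

Lemma frU_p : frU p.
Proof.
have u := metric_unit Bp; have [nu1 _] := nuF Bp.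
have rp : rawN p = \det (metric F p) *: nu p.
  by rewrite /rawN nu_jacobian // !mul0mx subr0.
rewrite /frU /= /rawN2 rp dotZl dotZr nu1 mulr1 -expr2 -exprD.
by rewrite lt_neqAle eq_sym expf_neq0 -?unitfE -?unitmxE //= (exprM _ 2 2) sqr_ge0.
Qed.

Lemma rowNE x a : rowN x 0 a = frN a x. Proof. by rewrite mxE mulrC. Qed.

Lemma rowN_J x : rowN x *m (J x)^T = 0.
Proof.
have H : nu p *m (J x)^T *m \adj (metric F x) *m J x *m (J x)^T =
    \det (metric F x) *: (nu p *m (J x)^T).
  by rewrite -mulmxA -metricE // -mulmxA mul_adj_mx mul_mx_scalar.
by rewrite -scalemxAl /rawN mulmxBl H -scalemxAl subrr scaler0.
Qed.

Lemma rowN1 x : frU x -> dot (rowN x) (rowN x) = 1.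
Proof.
move=> /frU_rawN2 H; rewrite dotZl dotZr -/(rawN2 x) mulrA -expr2 exprVn sqr_sqrtr ?mulVf //.
  by rewrite gt_eqF.
exact: ltW.
Qed.

Lemma frT_gram x : matT x = (J x)^T *m invmx (J x *m (J x)^T).
Proof. by rewrite /matT metricE. Qed.

Lemma fr_smX' a : sm frU (X a).
Proof. exact: (sm_sub (@subsetT _ _) (smooth_sm smF a)). Qed.

Lemma fr_smN' a : sm frU (frN a).
Proof.
have oU := frU_open; apply: (sm_mul oU); first exact: (sm_sub (@subsetT _ _) (sm_rawN a)).
apply: (sm_inv oU).
  by move=> y /frU_rawN2 H; rewrite gt_eqF // sqrtr_gt0.
apply: (sm_sqrt oU); first by move=> y /frU_rawN2.
exact: (sm_sub (@subsetT _ _) sm_rawN2).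
Qed.

Lemma fr_smT' a j : sm frU (frT a j).
Proof.
have oU := frU_open; have oT := @openT 'rV[R]_n.
have sd := sm_det oT (sm_metric smF).
apply: (sm_ext oU (f := fun x => \sum_i J x i a * ((\det (metric F x))^-1 * (\adj (metric F x)) i j))).
  move=> y Uy; rewrite /frT mxE; apply: eq_bigr => i _; rewrite [_^T _ _]mxE; congr (_ * _).
  by rewrite /invmx frU_unit // [RHS]mxE.
apply: (sm_sum oU) => i _; apply: (sm_mul oU).
  exact: (sm_sub (@subsetT _ _) (sm_jacobian smF i a)).
apply: (sm_mul oU); last exact: (sm_sub (@subsetT _ _) (sm_adj oT _ _ (sm_metric smF))).
apply: (sm_inv oU); last exact: (sm_sub (@subsetT _ _) sd).
by move=> y /frU_unit; rewrite unitmxE unitfE.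
Qed.

Lemma fr_N1' x : frU x -> \sum_a frN a x * frN a x = 1.
Proof. by move=> Ux; rewrite -(rowN1 Ux); apply: eq_bigr => a _; rewrite rowNE. Qed.

Lemma fr_NT' j x : frU x -> \sum_a frN a x * frT a j x = 0.
Proof.
move=> Ux; have := mul_nu_T (rowN_J x); rewrite -frT_gram => /rowP/(_ j).
by rewrite !mxE => {2}<-; apply: eq_bigr => a _; rewrite rowNE.
Qed.

Lemma fr_TX' i j x : frU x -> \sum_c frT c i x * 'D_(e j) (X c) x = (i == j)%:R.
Proof.
move=> Ux; have := mul_J_T (frU_gram Ux); rewrite -frT_gram => /matrixP/(_ j i).
rewrite mxE [RHS]mxE eq_sym => <-; apply: eq_bigr => c _.
by rewrite jacobianE // mulrC.
Qed.

Lemma dl_frT f a x : dl frT a f x = \sum_j matT x a j * 'D_(e j) f x.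
Proof. by rewrite dlE. Qed.

Lemma fr_dX' a b x : frU x -> dl frT a (X b) x = (a == b)%:R - frN a x * frN b x.
Proof.
move=> Ux; rewrite dl_frT.
have := resolution (frU_gram Ux) (rowN1 Ux) (rowN_J x); rewrite -frT_gram.
move=> /matrixP/(_ a b); rewrite mxE [RHS]mxE => <-.
rewrite [X in X + _ - _]mxE big_ord1 [_^T _ _]mxE !rowNE addrAC subrr add0r [RHS]mxE.
by apply: eq_bigr => j _; rewrite jacobianE.
Qed.

Lemma fr_proj' a b x : frU x ->
  ((J x)^T *m metric_inv F x *m J x) a b = (a == b)%:R - frN a x * frN b x.
Proof.
move=> Ux; rewrite -fr_dX' // dl_frT mxE; apply: eq_bigr => j _.
by rewrite jacobianE.
Qed.

Definition DN x : 'M[R]_(n, n.+1) := \matrix_(i, b) 'D_(e i) (frN b) x.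
Definition HN x : 'M[R]_n := \matrix_(i, j) \sum_b frN b x * 'D_(e i) ('D_(e j) (X b)) x.

Lemma HN_tr x : frU x -> (HN x)^T = HN x.
Proof.
move=> Ux; apply/matrixP => i j; rewrite !mxE; apply: eq_bigr => b _.
by rewrite (sm_derive_comm (e i) (e j) frU_open (fr_smX' b) Ux).
Qed.

Lemma DN_N x : frU x -> DN x *m (rowN x)^T = 0.
Proof.
move=> Ux; apply/matrixP => i j; rewrite !mxE ord1.
have oU := frU_open.
have : 'D_(e i) (fun y => \sum_b frN b y * frN b y) x = 0.
  by rewrite (derive_eqU oU (e i) Ux fr_N1') derive_cst.
have [|_ ->] := @is_deriveSf R _ _ (index_enum _) xpredT (fun b y => frN b y * frN b y) x (e i)
   (fun b => 2 * ('D_(e i) (frN b) x * frN b x)).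
  move=> b _; have D := sm_is_derive (e i) (fr_smN' b) Ux.
  have -> : 2 * ('D_(e i) (frN b) x * frN b x) =
    'D_(e i) (frN b) x * frN b x + frN b x * 'D_(e i) (frN b) x by ring.
  exact: (is_deriveMf D D).
rewrite -mulr_sumr => /eqP; rewrite mulf_eq0 pnatr_eq0 /= => /eqP H.
by rewrite -[RHS]H; apply: eq_bigr => b _; rewrite [DN x i b]mxE [_^T _ _]mxE rowNE.
Qed.

(** Weingarten's equation, from differentiating the orthogonality of N and the coordinate tangent
    vectors. *)
Lemma DN_J x : frU x -> DN x *m (J x)^T = - HN x.
Proof.
move=> Ux; apply/matrixP => i j; have oU := frU_open.
have H0 y : frU y -> \sum_b frN b y * 'D_(e j) (X b) y = 0.
  move=> Uy; have := rowN_J y => /rowP/(_ j); rewrite !mxE => {2}<-.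
  by apply: eq_bigr => b _; rewrite rowNE [_^T _ _]mxE jacobianE.
have : 'D_(e i) (fun y => \sum_b frN b y * 'D_(e j) (X b) y) x = 0.
  by rewrite (derive_eqU oU (e i) Ux H0) derive_cst.
have [|_ ->] := @is_deriveSf R _ _ (index_enum _) xpredT (fun b y => frN b y * 'D_(e j) (X b) y) x (e i)
   (fun b => 'D_(e i) (frN b) x * 'D_(e j) (X b) x + frN b x * 'D_(e i) ('D_(e j) (X b)) x).
  move=> b _; apply: is_deriveMf; first exact: (sm_is_derive (e i) (fr_smN' b) Ux).
  exact: (sm_is_derive (e i) (sm_derive (e j) (fr_smX' b)) Ux).
rewrite big_split /= => /eqP; rewrite addr_eq0 => /eqP H.
rewrite !mxE -H; apply: eq_bigr => b _.
by rewrite [DN x i b]mxE [_^T _ _]mxE jacobianE.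
Qed.

Lemma A_frame a b x : frU x ->
  A frT frN a b x = - (matT x *m HN x *m (matT x)^T) a b.
Proof.
move=> Ux; have := shape_mx (frU_gram Ux) (rowN1 Ux) (rowN_J x) (DN_N Ux) (DN_J Ux).
rewrite -frT_gram => /matrixP/(_ a b); rewrite [in RHS]mxE => <-.
by rewrite /A dl_frT mxE; apply: eq_bigr => j _; rewrite [DN x j b]mxE.
Qed.

Lemma A_frame_sym a b x : frU x -> A frT frN a b x = A frT frN b a x.
Proof.
move=> Ux; rewrite !A_frame //; congr (- _).
have : (matT x *m HN x *m (matT x)^T)^T = matT x *m HN x *m (matT x)^T.
  by rewrite trmx_mul (trmx_mul (matT x)) trmxK HN_tr // mulmxA.
by move=> /matrixP/(_ a b); rewrite [LHS]mxE => ->.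
Qed.

Lemma nu_frame x : frU x -> cball x ->
  exists2 c : R, c ^+ 2 = 1 & nu x = c *: rowN x.
Proof.
move=> Ux Bx; exists (dot (nu x) (rowN x)).
  have [nu1 _] := nuF Bx; rewrite -nu1.
  rewrite [in RHS](normal_line (frU_gram Ux) (rowN1 Ux) (rowN_J x) (nu_jacobian Bx)).
  by rewrite dotZl dotZr rowN1 // mulr1 expr2.
exact: (normal_line (frU_gram Ux) (rowN1 Ux) (rowN_J x) (nu_jacobian Bx)).
Qed.

Lemma sff_frame x c i j : nu x = c *: rowN x -> sff F nu x i j = c * HN x i j.
Proof.
move=> H; rewrite !mxE H dotZr; congr (_ * _); apply: eq_bigr => b _.
by rewrite rowNE ddF_coord // mulrC.
Qed.

Lemma matT_gram x : frU x -> (matT x)^T *m matT x = metric_inv F x.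
Proof. by move=> Ux; rewrite frT_gram (mul_T_T (frU_gram Ux)) /metric_inv metricE. Qed.

Lemma trA_frame x : frU x -> cball x -> trA frT frN x = 0.
Proof.
move=> Ux Bx; have [c c1 H] := nu_frame Ux Bx.
have -> : trA frT frN x = - \tr (matT x *m HN x *m (matT x)^T).
  by rewrite /mxtrace -sumrN; apply: eq_bigr => a _; rewrite A_frame.
have -> : \tr (matT x *m HN x *m (matT x)^T) = \sum_i \sum_j metric_inv F x i j * HN x i j.
  by rewrite frT_gram (tr_shape (frU_gram Ux) (HN_tr Ux)) /metric_inv metricE.
have := minF Bx; rewrite /mean_curv.
under eq_bigr do (under eq_bigr do rewrite (sff_frame _ _ H) mulrCA; rewrite -mulr_sumr).
rewrite -mulr_sumr => /eqP; rewrite mulf_eq0 => /orP[/eqP c0|/eqP ->]; last by rewrite oppr0.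
by move: c1; rewrite c0 expr0n /= => /esym/eqP; rewrite oner_eq0.
Qed.

Lemma sA_frame x : frU x -> cball x -> normA2 F nu x = sA frT frN x.
Proof.
move=> Ux Bx; have [c c1 H] := nu_frame Ux Bx.
rewrite /sA; under [RHS]eq_bigr do (under eq_bigr do rewrite A_frame // mulrNN).
rewrite (sqr_shape (matT x) (HN_tr Ux)) matT_gram //.
apply: eq_bigr => i _; apply: eq_bigr => j _; apply: eq_bigr => k _; apply: eq_bigr => l _.
rewrite !(sff_frame _ _ H).
rewrite -[RHS]mul1r -c1; ring.
Qed.

Lemma frame_at : frU p /\ is_frame F nu frU frT frN.
Proof.
split; first exact: frU_p; split.
- exact: frU_open.
- exact: fr_smT'.
- exact: fr_smX'.
- exact: fr_smN'.
- exact: fr_N1'.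
- exact: fr_NT'.
- exact: fr_TX'.
- exact: fr_dX'.
- by move=> a b x Ux; exact: A_frame_sym.
- exact: sA_frame.
- exact: trA_frame.
- exact: fr_proj'.
- move=> x Ux Bx; have [c c1 ->] := nu_frame Ux Bx; exists c => // a.
  by rewrite mxE rowNE.
Qed.
End FrameExists.

(** * Maximum principle on the ball *)

Section Ball.
Variables (R : realType) (n : nat).
Implicit Types x y v : 'rV[R]_n.

Lemma dot_continuous : continuous (fun x : 'rV[R]_n => dot x x).
Proof.
move=> x; apply: continuous_sumf => k.
by apply: (@continuousM _ _ (fun y : 'rV[R]_n => y 0 k) (fun y : 'rV[R]_n => y 0 k));
  exact: coord_continuous.
Qed.

Lemma coord_sqr_le_dot x k : x 0 k ^+ 2 <= dot x x.
Proof.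
rewrite /dot (bigD1 k) //= -expr2 lerDl; apply: sumr_ge0 => i _.
by rewrite -expr2 sqr_ge0.
Qed.

Lemma cball_compact : compact (@cball R n).
Proof.
apply: bounded_closed_compact.
  exists 1; split => // M M1 x /= xB; apply: norm_ler; first by rewrite ltW // (lt_trans ltr01).
  move=> j; apply: (le_trans _ (ltW M1)).
  rewrite -(@ler_pXn2r _ 2) ?nnegrE // expr1n -normrX ger0_norm ?sqr_ge0 //.
  exact: (le_trans (coord_sqr_le_dot x j)).
rewrite (_ : @cball R n = (fun x => dot x x) @^-1` [set t : R | t <= 1]) //.
by apply: closed_comp; [move=> x _; exact: dot_continuous|exact: closed_le].
Qed.

Lemma usphere_cball : @usphere R n `<=` @cball R n.
Proof. by move=> x; rewrite /usphere /cball /= => ->. Qed.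

Lemma usphere_compact : compact (@usphere R n).
Proof.
apply: (subclosed_compact _ cball_compact); last exact: usphere_cball.
rewrite (_ : @usphere R n = (fun x => dot x x) @^-1` [set t : R | t = 1]) //.
by apply: closed_comp; [move=> x _; exact: dot_continuous|exact: closed_eq].
Qed.

Definition oball : set 'rV[R]_n := [set x | dot x x < 1].
Lemma oball_open : open oball.
Proof.
rewrite (_ : oball = (fun x => dot x x) @^-1` [set t : R | t < 1]) //.
by apply: open_comp; [move=> x _; exact: dot_continuous|exact: open_lt].
Qed.
Lemma oball_cball : oball `<=` @cball R n. Proof. by move=> x /ltW. Qed.

Lemma cball_inward x v : dot x x = 1 -> dot v x < 0 ->
  exists2 r : R, 0 < r & forall t, 0 < t < r -> cball (x + t *: v).
Proof.
move=> xx vx; have k0 := dot_ge0 v; pose k := dot v v.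
have k1 : 0 < k + 1 by rewrite ltr_wpDl.
(* From |x + t v|^2 = 1 + t (2 <v, x> + t |v|^2); the summand 1 keeps the denominator positive. *)
exists (- 2 * dot v x / (k + 1)); first by rewrite divr_gt0 // nmulr_rgt0 // oppr_lt0.
move=> t /andP[t0]; rewrite ltr_pdivlMr // => tr.
rewrite /cball /= !(dotDl, dotDr, dotZl, dotZr) xx (dotC x v) -/k.
have : t * k <= - 2 * dot v x by rewrite ltW // (le_lt_trans _ tr) // ler_pM2l // lerDl.
rewrite -/k in k0 *; move: (dot v x) => b H.
have : t * (t * k) <= t * (- 2 * b) by rewrite ler_pM2l.
lra.
Qed.

Lemma cball_scale x (t : R) : cball x -> 0 <= t <= 1 -> cball (t *: x).
Proof.
move=> xB /andP[t0 t1]; rewrite /cball /= dotZl dotZr mulrA.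
apply: (le_trans (ler_piMl _ _)) => //; first exact: dot_ge0.
by rewrite mulr_ile1.
Qed.

(** The dual cone of an open half-space is a ray. With w the part of z orthogonal to x, the test
    vector - w - eta x gives |w|^2 <= - eta c for all eta > 0; a small eta forces w = 0, and then
    eta = 1 gives the sign of c. *)
Lemma inward_cone x (z : 'rV[R]_n) : dot x x = 1 ->
  (forall v, dot v x < 0 -> 0 <= dot v z) -> z = dot z x *: x /\ dot z x <= 0.
Proof.
move=> xx H; pose c := dot z x; pose w := z - c *: x.
have wx : dot w x = 0.
  by rewrite /w -scaleNr dotDl dotZl xx mulr1 -/c subrr.
have zE : z = w + c *: x by rewrite subrK.
clearbody w.
have zw : dot w z = dot w w by rewrite zE dotDr dotZr wx mulr0 addr0.
have Hv (eta : R) : 0 < eta -> dot w w <= - (eta * c).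
  move=> eta0; have := H (- 1 *: w + (- eta) *: x).
  rewrite !dotDl !dotZl wx xx mulr0 add0r mulr1 oppr_lt0 => /(_ eta0).
  by rewrite zw (dotC x z) -/c; lra.
have w0 : dot w w = 0.
  apply/eqP; rewrite eq_le dot_ge0 andbT leNgt; apply/negP => w0.
  have d0 : 0 < 2 * (`|c| + 1) by rewrite mulr_gt0 // ltr_wpDl.
  pose k := dot w w / (2 * (`|c| + 1)).
  have k0 : 0 < k by exact: divr_gt0.
  have wE : dot w w = k * (2 * (`|c| + 1)) by rewrite divfK // gt_eqF.
  have := Hv k k0; rewrite wE -subr_le0 opprK -mulrDr pmulr_rle0 //.
  have := ler_norm (- c); rewrite normrN; have := normr_ge0 c; lra.
split; last by have := Hv 1 ltr01; rewrite w0 mul1r oppr_ge0.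
by rewrite [LHS]zE; move/eqP: w0; rewrite dot_eq0 => /eqP ->; rewrite add0r.
Qed.

(** Smooth formulas for |A|^2 exist only in local frames, so continuity on the closed ball is
    checked frame by frame. *)
Lemma within_continuous_local (A : set 'rV[R]_n) (f : 'rV[R]_n -> R) :
  (forall x, A x -> exists U g, [/\ open U, U x, {for x, continuous g} &
     forall y, U y -> A y -> f y = g y]) -> {within A, continuous f}.
Proof.
move=> H; apply/subspace_continuousP => x Ax.
have [U [g [oU Ux cg fg]]] := H x Ax.
move=> B fB; have gB := cg B; rewrite /= -(fg x Ux Ax) in gB; have {}gB := gB fB.
have nU : nbhs x U by exact: open_nbhs_nbhs.
apply: (nearS2 _ nU gB) => y Uy gy Ay; have E1 := fg y Uy Ay.
by move: gy; rewrite /preimage /= -E1.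
Qed.
End Ball.

Section FrameRestriction.
Variables (R : realType) (n : nat) (F nu : 'rV[R]_n -> 'rV[R]_n.+1).

Lemma is_frame_sub U W T N : is_frame F nu U T N -> open W -> W `<=` U -> is_frame F nu W T N.
Proof.
move=> [h0 h1 h2 h3 h4 h5 h6 h7 h8 h9 h10 h11 h12] oW WU; split => //.
- by move=> a j; exact: sm_sub (h1 a j).
- by move=> a; exact: sm_sub (h2 a).
- by move=> a; exact: sm_sub (h3 a).
- by move=> x /WU; exact: h4.
- by move=> j x /WU; exact: h5.
- by move=> i j x /WU; exact: h6.
- by move=> a b x /WU; exact: h7.
- by move=> a b x /WU; exact: h8.
- by move=> x /WU; exact: h9.
- by move=> x /WU; exact: h10.
- by move=> a b x /WU; exact: h11.
- by move=> x /WU; exact: h12.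
Qed.

Lemma qX_dot x : qX (coordF F) x = dot (F x) (F x). Proof. by []. Qed.
End FrameRestriction.

(** * Maxima of test functions under the free boundary condition *)

Section FreeBoundary.
Variables (R : realType) (n : nat) (hn : (0 < n)%N).
Variables (F nu : 'rV[R]_n -> 'rV[R]_n.+1).
Hypothesis smF : smooth F.
Hypothesis immF : immersion_on F (@cball R n).
Hypothesis nuF : forall x, cball x -> dot (nu x) (nu x) = 1 /\ forall i, dot (nu x) (dF F i x) = 0.
Hypothesis minF : forall x, cball x -> mean_curv F nu x = 0.
Hypothesis sphF : forall x, usphere x -> dot (F x) (F x) = 1.
Hypothesis freeF : forall x, usphere x -> dot (nu x) (F x) = 0.
Local Notation e j := (delta_mx 0 j : 'rV[R]_n).
Local Notation X := (coordF F).
Local Notation s := (normA2 F nu).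
Local Notation q x := (dot (F x) (F x)).
Implicit Types x y v : 'rV[R]_n.

Lemma exists_frame p : cball p -> exists U T N, U p /\ is_frame F nu U T N.
Proof.
move=> Bp; exists (frU F nu p), (frT F), (frN F nu p).
exact: (frame_at smF immF nuF minF Bp).
Qed.

(** One family for all comparison arguments: the coefficients 1, 0, 0 give |A|^2, the coefficients
    0, 0, 1 give |F|^2, and 1/2, - eps/4, al/2 the function that yields the contradiction. *)
Definition test (k1 k2 k3 : R) x : R := k1 * s x + k2 * (s x * s x) + k3 * q x.
Definition ltest T N (k1 k2 k3 : R) x : R :=
  k1 * sA T N x + k2 * (sA T N x * sA T N x) + k3 * qX X x.

Lemma test_local U T N k1 k2 k3 x : is_frame F nu U T N -> U x -> cball x ->
  test k1 k2 k3 x = ltest T N k1 k2 k3 x.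
Proof. by move=> fr Ux Bx; rewrite /test /ltest (fr_sA fr Ux Bx). Qed.

Lemma sm_ltest U T N k1 k2 k3 : is_frame F nu U T N -> sm U (ltest T N k1 k2 k3).
Proof.
move=> fr; have oU := fr_open fr.
have ss := sm_sA oU (fr_smT fr) (fr_smN fr).
have sq := sm_qX oU (fr_smX fr).
apply: (sm_add oU); last by apply: (sm_mul oU) => //; exact: sm_cst.
by apply: (sm_add oU); apply: (sm_mul oU) => //; first [exact: sm_cst | exact: (sm_mul oU ss ss)].
Qed.

Lemma test_continuous k1 k2 k3 : {within @cball R n, continuous (test k1 k2 k3)}.
Proof.
apply: within_continuous_local => x Bx; have [U [T [N [Ux fr]]]] := exists_frame Bx.
exists U, (ltest T N k1 k2 k3); split => //; first exact: fr_open fr.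
  exact: (sm_cont (sm_ltest _ _ _ fr) Ux).
by move=> y Uy By; exact: (test_local _ _ _ fr).
Qed.

Lemma cball0 : cball (0 : 'rV[R]_n).
Proof. by rewrite /cball /= /dot big1 // => k _; rewrite mxE mul0r. Qed.

Definition pole : 'rV[R]_n := delta_mx 0 (Ordinal hn).
Lemma usphere_pole : usphere pole.
Proof.
rewrite /usphere /= /dot (bigD1 (Ordinal hn)) //= mxE !eqxx mulr1 big1 ?addr0 // => i ij.
by rewrite mxE (negbTE ij) andbF mul0r.
Qed.

Lemma test_max k1 k2 k3 : exists2 x, cball x & forall y, cball y -> test k1 k2 k3 y <= test k1 k2 k3 x.
Proof.
have [|x] := compact_EVT_max _ (@cball_compact R n) (@test_continuous k1 k2 k3).
  by exists 0; exact: cball0.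
rewrite inE => Bx H; exists x => // y By; apply: H; by rewrite inE.
Qed.

Lemma s_max_sphere : exists2 x, usphere x & forall y, usphere y -> s y <= s x.
Proof.
have c : {within @usphere R n, continuous s}.
  apply: (continuous_subspaceW (@usphere_cball R n)).
  have := @test_continuous 1 0 0.
  by rewrite (_ : test 1 0 0 = s) //; apply/funext => x; rewrite /test !mul0r mul1r !addr0.
have [|x] := compact_EVT_max _ (@usphere_compact R n) c.
  by exists pole; exact: usphere_pole.
rewrite inE => Bx H; exists x => // y By; apply: H; by rewrite inE.
Qed.

Lemma s_ge0 x : cball x -> 0 <= s x.
Proof.
move=> Bx; have [U [T [N [Ux fr]]]] := exists_frame Bx.
by rewrite (fr_sA fr Ux Bx); exact: sA_ge0.
Qed.

(** Inside the open ball the frame can be shrunk so that the trace vanishes on all of U, as the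
    Laplacian computations require. *)
Lemma interior_frame x : dot x x < 1 ->
  exists U T N, [/\ U x, is_frame F nu U T N & U `<=` @cball R n].
Proof.
move=> x1; have [U [T [N [Ux fr]]]] := exists_frame (oball_cball x1).
exists (U `&` @oball R n), T, N; split => //.
  apply: (is_frame_sub fr); last by move=> y [].
  by apply: openI; [exact: fr_open fr|exact: oball_open].
by move=> y [_]; exact: oball_cball.
Qed.

Lemma interior_max k1 k2 k3 x : dot x x < 1 ->
  (forall y, cball y -> test k1 k2 k3 y <= test k1 k2 k3 x) ->
  exists U T N, [/\ U x, is_frame F nu U T N, U `<=` @cball R n &
   \sum_c dl T c (dl T c (ltest T N k1 k2 k3)) x <= 0].
Proof.
move=> x1 H; have [U [T [N [Ux fr UB]]]] := interior_frame x1.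
exists U, T, N; split => //.
apply: (max_lap_le0 (fr_open fr) (fr_smT fr) (sm_ltest _ _ _ fr) Ux).
apply: filterS (open_nbhs_nbhs (conj (fr_open fr) Ux)) => y Uy.
rewrite -(test_local _ _ _ fr Uy (UB _ Uy)) -(test_local _ _ _ fr Ux (UB _ Ux)).
by apply: H; exact: UB.
Qed.

Lemma interior_max_test (eps al : R) x : dot x x < 1 ->
  (forall y, cball y -> test 2^-1 (- eps / 4) (al / 2) y <= test 2^-1 (- eps / 4) (al / 2) x) ->
  0 <= eps -> 3 * eps * s x <= 1 -> al * n%:R <= (1 - eps * s x) * s x ^+ 2.
Proof.
move=> x1 H e0 e1; have [U [T [N [Ux fr UB L]]]] := interior_max x1 H.
have sE := fr_sA fr Ux (UB _ Ux); rewrite sE in e1 *.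
have := @lap_test_ge R n U (fr_open fr) T (fr_smT fr) X N (fr_smX fr) (fr_smN fr) (fr_N1 fr)
  (fr_NT fr) (fr_TX fr) (fr_dX fr) (fr_sym fr) eps al x
  (fun y Uy => fr_tr fr Uy (UB _ Uy)) Ux e0 e1.
by move=> /le_trans /(_ L); rewrite subr_le0.
Qed.

(** The Laplacian of |F|^2 is 2 n > 0, so its maximum lies on the sphere of the domain, where |F| =
    1. *)
Lemma q_le1 x : cball x -> q x <= 1.
Proof.
have [z Bz H] := test_max 0 0 1.
have tE y : test 0 0 1 y = q y by rewrite /test !mul0r !add0r mul1r.
have {}H y : cball y -> q y <= q z by move=> /H; rewrite !tE.
move=> Bx; apply: (le_trans (H x Bx)).
have [z1|z1] := eqVneq (dot z z) 1; first by rewrite sphF.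
have zlt : dot z z < 1 by rewrite lt_neqAle z1.
have [|U [T [N [Uz fr UB]]]] := @interior_max 0 0 1 z zlt; first by move=> y /H; rewrite !tE.
rewrite (lap_test (fr_open fr) (fr_smT fr) (fr_smX fr) (fr_smN fr) (fr_N1 fr) (fr_NT fr)
  (fr_dX fr) 0 0 1 Uz (fr_tr fr Uz (UB _ Uz))).
by rewrite !(mulr0, mul0r, add0r) mulr1 leNgt mulr_gt0 ?ltr0n.
Qed.

Lemma derive_ball_le0 U (f : 'rV[R]_n -> R) x v : open U -> sm U f -> U x -> usphere x ->
  dot v x < 0 -> (forall y, U y -> cball y -> f y <= f x) -> 'D_v f x <= 0.
Proof.
move=> oU Fs Ux xx vx H.
have [r r0 Hr] := cball_inward xx vx.
have [r' r'0 Hr'] := near_line v (open_nbhs_nbhs (conj oU Ux)).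
apply: (@derive_le0 R _ f x v (Num.min r r')); first by rewrite lt_min r0.
  exact: sm_derivable Fs Ux.
move=> t /andP[t0]; rewrite lt_min => /andP[t1 t2]; apply: H.
  by apply: Hr'; rewrite gtr0_norm.
by apply: Hr; rewrite t0.
Qed.

Lemma boundary_frame_hyps U T N : is_frame F nu U T N ->
  (forall y, U y -> dot y y = 1 -> qX X y = 1) /\
  (forall y, U y -> dot y y = 1 -> wX X N y = 0).
Proof.
move=> fr; split=> y Uy yy; first exact: sphF.
have [c c1 cN] := fr_nu fr Uy (usphere_cball yy).
have : c * wX X N y = 0.
  rewrite -(freeF yy) /wX mulr_sumr; apply: eq_bigr => a _.
  by rewrite cN /coordF; ring.
move=> /eqP; rewrite mulf_eq0 => /orP[/eqP c0|/eqP //].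
by move: c1; rewrite c0 expr0n /= => /esym/eqP; rewrite oner_eq0.
Qed.

Lemma derive_qX_ge0 U T N x : is_frame F nu U T N -> U x -> usphere x -> 0 <= 'D_x (qX X) x.
Proof.
move=> fr Ux xx; have oU := fr_open fr; have sq := sm_qX oU (fr_smX fr).
have [_ DN'] := is_derive_oppdir (sm_derivable (v := x) sq Ux).
rewrite -oppr_le0 -DN'; apply: (derive_ball_le0 oU sq Ux xx).
  by rewrite -scaleN1r dotZl xx mulr1 oppr_lt0.
by move=> y Uy By; rewrite !qX_dot (sphF xx); exact: q_le1.
Qed.

(** At a boundary maximum the derivative in the outward direction F is nonnegative: (k1 + 2 k2 s)
    d_F s + 2 k3 >= 0. It remains to insert d_F s <= -2 s, which the sign of the coefficient
    allows. *)
Lemma boundary_max k1 k2 k3 x : usphere x -> 0 <= k1 + 2 * k2 * s x ->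
  (forall y, cball y -> test k1 k2 k3 y <= test k1 k2 k3 x) ->
  (k1 + 2 * k2 * s x) * s x <= k3.
Proof.
move=> xx k0 H; have Bx := usphere_cball xx.
have [U [T [N [Ux fr]]]] := exists_frame Bx; have oU := fr_open fr.
have [sph1 sphw] := boundary_frame_hyps fr.
have smT := fr_smT fr; have smX := fr_smX fr; have smN := fr_smN fr.
have ss := sm_sA oU smT smN; have sq := sm_qX oU smX.
have q0 := derive_qX_ge0 fr Ux xx.
have vx := vF_outward oU smX (fr_dX fr) sph1 sphw Ux xx q0.
set v := vF T X x in vx.
have vN : dot (- v) x < 0 by rewrite -scaleN1r dotZl mulN1r oppr_lt0.
have DvN f : sm U f -> 'D_(- v) f x = - \sum_a X a x * dl T a f x.
  move=> Fs; have [_ ->] := is_derive_oppdir (sm_derivable (v := v) Fs Ux).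
  by rewrite (derive_vF oU T X Fs Ux).
(* The trace vanishes on the closed ball, so both it and its opposite are maximal at x there; the
   two one-sided inequalities give a zero derivative. *)
have tr0 : \sum_a X a x * dl T a (trA T N) x = 0.
  apply/eqP; rewrite -oppr_eq0 -DvN; last exact: (sm_trA oU smT smN).
  have st := sm_trA oU smT smN.
  rewrite eq_le; apply/andP; split.
    apply: (derive_ball_le0 oU st Ux xx vN) => y Uy By.
    by rewrite !(fr_tr fr).
  rewrite -oppr_le0 -deriveN; last exact: sm_derivable st Ux.
  apply: (derive_ball_le0 oU (sm_opp oU st) Ux xx vN) => y Uy By.
  by rewrite !(fr_tr fr).
have Hs := boundary_sA oU smT smX smN (fr_N1 fr) (fr_TX fr) (fr_dX fr) (fr_sym fr)
  sph1 sphw Ux xx (fr_tr fr Ux Bx) tr0.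
have Hq : \sum_c X c x * dl T c (qX X) x = 2.
  rewrite (eq_bigr (fun c => 2 * (X c x * X c x))).
    by rewrite -mulr_sumr -/(qX X x) sph1 // mulr1.
  by move=> c _; rewrite (dl_qX oU smX (fr_dX fr)) // sphw // mul0r subr0 mulrCA.
have : 'D_(- v) (ltest T N k1 k2 k3) x <= 0.
  apply: (derive_ball_le0 oU (sm_ltest _ _ _ fr) Ux xx vN) => y Uy By.
  rewrite -(test_local _ _ _ fr Uy By) -(test_local _ _ _ fr Ux Bx); exact: H.
rewrite DvN; last exact: sm_ltest fr.
have smk (k : R) f : sm U f -> sm U (fun y => k * f y).
  by move=> Fs; exact: (sm_mul oU (sm_cst oU k) Fs).
have smSS := sm_mul oU ss ss.
rewrite (eq_bigr (fun c => (k1 + 2 * k2 * s x) * (X c x * dl T c (sA T N) x) +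
   k3 * (X c x * dl T c (qX X) x))).
  rewrite big_split /= -!mulr_sumr Hq oppr_le0; set D := \sum_c _ in Hs *.
  rewrite -(fr_sA fr Ux Bx) in Hs.
  have := ler_wpM2l k0 Hs; lra.
move=> c _; rewrite (dl_add T c (sm_add oU (smk k1 _ ss) (smk k2 _ smSS)) (smk k3 _ sq) Ux).
rewrite (dl_add T c (smk k1 _ ss) (smk k2 _ smSS) Ux).
rewrite (dl_scale oU T c k1 ss Ux) (dl_scale oU T c k2 smSS Ux) (dl_scale oU T c k3 sq Ux).
rewrite (dl_mul T c ss ss Ux) (fr_sA fr Ux Bx).
have aux (x0 a b d : R) : x0 * (k1 * a + k2 * (a * b + b * a) + k3 * d) =
  (k1 + 2 * k2 * b) * (x0 * a) + k3 * (x0 * d) by ring.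
exact: aux.
Qed.

(** With eps = 1/(6 S) one has eps s0 <= 1/6, which makes t^2 (1 - eps t) at most its value at S.
    Since S^2 <= n c, the gap from S^2 (1 - eps S) to n c (1 - eps s1) is at least n c eps (S - s1);
    [del] is half of this, so that n al lies strictly inside the gap. *)
Lemma test_constants (S s0 s1 c eps al del : R) : 0 < S -> S ^+ 2 <= n%:R * c -> s1 < S ->
  eps = (6 * S)^-1 -> del = n%:R * c * eps * (S - s1) / 2 ->
  al * n%:R = S ^+ 2 * (1 - eps * S) + del ->
  0 <= s0 <= S ->
  [/\ al * n%:R <= (1 - eps * s0) * s0 ^+ 2 -> False &
     c <= s0 -> s0 <= s1 -> (1 - eps * s0) * s0 <= al -> False].
Proof.
move=> S0 Sc s1S epsE delE alE /andP[s00 s0S].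
have e0 : 0 < eps by rewrite epsE invr_gt0 mulr_gt0.
have eS : eps * S = 6^-1 by rewrite epsE invfM -mulrA mulVf ?mulr1 // gt_eqF.
have nc0 : 0 < n%:R * c by apply: lt_le_trans Sc; rewrite exprn_gt0.
have n0 : 0 < n%:R :> R by rewrite ltr0n.
have c0 : 0 < c by rewrite -(pmulr_rgt0 _ n0).
have d0 : 0 < del by rewrite delE divr_gt0 // mulr_gt0 ?subr_gt0 // mulr_gt0.
split=> [H|cs ss H].
- have : S ^+ 2 * (1 - eps * S) < S ^+ 2 * (1 - eps * S) + 0.
    rewrite -{1}[X in X < _]addr0; apply: (lt_le_trans (y := al * n%:R)).
      by rewrite alE ltrD2l.
    apply: (le_trans H); rewrite addr0 -subr_ge0.
    rewrite (_ : _ - _ = (S - s0) * (S * (1 - eps * S - eps * s0) + s0 * (1 - eps * s0))); last by ring.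
    have es : eps * s0 <= 6^-1 by rewrite -eS ler_pM2l.
    apply: mulr_ge0; first by rewrite subr_ge0.
    apply: addr_ge0; apply: mulr_ge0 => //; first exact: ltW.
      by rewrite eS; lra.
    by lra.
  by rewrite addr0 ltxx.
- have es : eps * s0 <= eps * s1 by rewrite ler_pM2l.
  have es1 : eps * s1 < eps * S by rewrite ltr_pM2l.
  have H1 : (1 - eps * s1) * c <= (1 - eps * s0) * s0.
    apply: ler_pM => //; [lra|exact: ltW|lra].
  have H2 : n%:R * ((1 - eps * s1) * c) <= n%:R * al.
    by rewrite ler_pM2l // (le_trans H1).
  have H3 : S ^+ 2 * (1 - eps * S) <= n%:R * c * (1 - eps * S).
    by rewrite ler_pM2r // eS; lra.
  have H4 : 0 < n%:R * c * (eps * S - eps * s1) by rewrite mulr_gt0 // subr_gt0.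
  move: H2; rewrite [n%:R * al]mulrC alE delE.
  have -> : n%:R * ((1 - eps * s1) * c) = n%:R * c * (1 - eps * S) + n%:R * c * (eps * S - eps * s1).
    by ring.
  have -> : n%:R * c * eps * (S - s1) / 2 = n%:R * c * (eps * S - eps * s1) / 2 by ring.
  by move: H3 H4; lra.
Qed.

Lemma inf_lt_sqr_sup (S c : R) : (forall x, cball x -> s x <= S) -> (forall x, usphere x -> c <= s x) ->
  0 < S -> n%:R * c < S ^+ 2.
Proof.
move=> sS cs S0; rewrite ltNge; apply/negP => Sc.
have [p1 p1s p1max] := s_max_sphere.
have p1b := usphere_cball p1s.
have tE y : test 1 0 0 y = s y by rewrite /test !mul0r mul1r !addr0.
(* If S were attained on the boundary, [boundary_max] for |A|^2 itself would give s p1 <= 0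
   there. *)
have s1S : s p1 < S.
  rewrite ltNge; apply/negP => Ss.
  have : (1 + 2 * 0 * s p1) * s p1 <= 0.
    apply: boundary_max => //; first by rewrite mulr0 mul0r addr0.
    by move=> y By; rewrite !tE (le_trans (sS y By)).
  rewrite mulr0 mul0r addr0 mul1r => /(le_trans Ss); rewrite leNgt S0 //.
pose eps := (6 * S)^-1; pose del := n%:R * c * eps * (S - s p1) / 2.
pose al := (S ^+ 2 * (1 - eps * S) + del) / n%:R.
have n0 : n%:R != 0 :> R by rewrite pnatr_eq0 -lt0n.
have e0 : 0 < eps by rewrite invr_gt0 mulr_gt0.
have eS : eps * S = 6^-1 by rewrite /eps invfM -mulrA mulVf ?mulr1 // gt_eqF.
have [x Bx xmax] := test_max 2^-1 (- eps / 4) (al / 2).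
have sx : 0 <= s x <= S by rewrite s_ge0 // sS.
have es : eps * s x <= 6^-1 by rewrite -eS ler_pM2l //; case/andP: sx.
have [A1 A2] := @test_constants S (s x) (s p1) c eps al del S0 Sc s1S erefl erefl (divfK n0 _) sx.
have [xs|xs] := eqVneq (dot x x) 1.
  apply: A2; [exact: cs|exact: p1max|].
  have K : 2^-1 + 2 * (- eps / 4) * s x = 2^-1 * (1 - eps * s x) by field.
  have := @boundary_max 2^-1 (- eps / 4) (al / 2) x xs _ xmax.
  rewrite K -mulrA [al / 2]mulrC ler_pM2l ?invr_gt0 //; apply.
  by rewrite mulr_ge0 ?invr_ge0 //; lra.
apply: A1; apply: (interior_max_test _ xmax); first by rewrite lt_neqAle xs.
  exact: ltW.
by rewrite -mulrA; lra.
Qed.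

(** * The totally geodesic case *)

Section Flat.
Hypothesis s0 : forall x, cball x -> s x = 0.

(** A vanishing sum of squares gives A = 0, and [TX] recovers the coordinate derivatives of N from
    those of the frame. Products of components are used because local normals agree only up to
    sign. *)
Lemma flat_frame U T N x a b i : is_frame F nu U T N -> U x -> cball x ->
  'D_(e i) (fun y => N a y * N b y) x = 0.
Proof.
move=> fr Ux Bx; have oU := fr_open fr.
have A0 c d : A T N c d x = 0.
  have := s0 Bx; rewrite (fr_sA fr Ux Bx) /sA => /eqP.
  have pos c' : 0 <= \sum_d A T N c' d x * A T N c' d x.
    by apply: sumr_ge0 => d' _; rewrite -expr2 sqr_ge0.
  rewrite psumr_eq0 => [/allP /(_ c (mem_index_enum c)) /=|c' _]; last exact: pos.
  rewrite psumr_eq0 => [/allP /(_ d (mem_index_enum d)) /=|d' _]; last by rewrite -expr2 sqr_ge0.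
  by rewrite -expr2 sqrf_eq0 => /eqP.
have DN0 d : 'D_(e i) (N d) x = 0.
  transitivity (\sum_j (j == i)%:R * 'D_(e j) (N d) x).
    rewrite (bigD1 i) //= eqxx mul1r big1 ?addr0 // => j ji.
    by rewrite (negbTE ji) mul0r.
  under eq_bigr do rewrite -(fr_TX fr _ _ Ux) mulr_suml.
  rewrite exchange_big big1 // => c _.
  under eq_bigr do rewrite mulrAC.
  by rewrite -mulr_suml -dlE -/(A T N c d) A0 mul0r.
have [_ ->] := is_deriveMf (sm_is_derive (e i) (fr_smN fr a) Ux) (sm_is_derive (e i) (fr_smN fr b) Ux).
by rewrite !DN0 mul0r mulr0 addr0.
Qed.

(** The projection onto the tangent hyperplane involves no choice of normal, so it can be followed
    along segments from the origin across different frames. *)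
Definition projF a b x : R :=
  ((Pilot.Defs.jacobian F x)^T *m metric_inv F x *m Pilot.Defs.jacobian F x) a b.

Lemma projF_nu a b x : cball x -> projF a b x = (a == b)%:R - nu x 0 a * nu x 0 b.
Proof.
move=> Bx; have [U [T [N [Ux fr]]]] := exists_frame Bx.
rewrite /projF (fr_proj fr) //; congr (_ - _).
have [c c1 cN] := fr_nu fr Ux Bx.
by rewrite !cN mulrACA -expr2 c1 mul1r.
Qed.

Lemma projF_derive a b x v : cball x -> is_derive x v (projF a b) 0.
Proof.
move=> Bx; have [U [T [N [Ux fr]]]] := exists_frame Bx; have oU := fr_open fr.
have smNN : sm U (fun y => N a y * N b y) by exact: (sm_mul oU (fr_smN fr a) (fr_smN fr b)).
have D : 'D_v (fun y => N a y * N b y) x = 0.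
  by rewrite (sm_deriveE _ oU smNN Ux) big1 // => i _; rewrite (flat_frame _ _ _ fr Ux Bx) mulr0.
have := is_deriveBf (is_derive_cst ((a == b)%:R : R) x v) (sm_is_derive v smNN Ux).
rewrite D subr0; apply: near_eq_is_derive.
by apply: (near_eqU oU Ux) => y Uy; rewrite /projF (fr_proj fr).
Qed.

Lemma projF_const a b x : cball x -> projF a b x = projF a b 0.
Proof.
move=> Bx; have [|t /andP[t0 t1]] := @MVT_line_gt0 R _ (projF a b) 0 x 1 ltr01.
  by move=> t t01; rewrite add0r; case: (projF_derive a b x (cball_scale Bx t01)).
rewrite add0r scale1r mul1r add0r => /eqP; rewrite subr_eq => /eqP ->.
have [|_ ->] := projF_derive a b x (cball_scale (t := t) Bx _); last by rewrite add0r.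
by rewrite !ltW.
Qed.

Lemma nu_const a b x : cball x -> nu x 0 a * nu x 0 b = nu 0 0 a * nu 0 0 b.
Proof.
move=> Bx; have := projF_const a b Bx; rewrite !projF_nu //; last exact: cball0.
by move=> /addrI /oppr_inj.
Qed.

(** [nu_const] fixes [nu] up to sign, and orthogonality does not see the sign. *)
Lemma nu_dot0 x (y : 'rV[R]_n.+1) : cball x -> dot (nu x) y = 0 <-> dot (nu 0) y = 0.
Proof.
have H x1 x2 (z : 'rV[R]_n.+1) : cball x1 -> cball x2 -> dot (nu x1) z = 0 -> dot (nu x2) z = 0.
  move=> B1 B2 z0; have [nu1 _] := nuF B2.
  have E0 b : nu x2 0 b * dot (nu x2) z = 0.
    transitivity (nu x1 0 b * dot (nu x1) z); last by rewrite z0 mulr0.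
    rewrite !mulr_sumr; apply: eq_bigr => a _.
    by rewrite !mulrA nu_const // [in RHS]nu_const.
  rewrite -[LHS]mul1r -nu1 mulr_suml big1 // => b _.
  by rewrite -mulrA E0 mulr0.
by move=> Bx; split; apply: H => //; exact: cball0.
Qed.

(** The function <nu 0, F> has zero derivative because every tangent space is orthogonal to [nu 0];
    its constant value is read off at the boundary point [pole] from the free boundary condition. *)
Lemma flat_height x : cball x -> dot (nu 0) (F x) = 0.
Proof.
pose G x := \sum_a nu 0 0 a * X a x.
have oT := @openT 'rV[R]_n.
have smG : sm setT G.
  by apply: (sm_sum oT) => a _; apply: (sm_mul oT (sm_cst oT _)); exact: smooth_sm.
have DG y v : cball y -> 'D_v G y = 0.
  move=> By; rewrite (sm_deriveE _ oT smG I) big1 // => j _.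
  have [|_ ->] := @is_deriveSf R _ _ (index_enum _) xpredT (fun a y => nu 0 0 a * X a y) y (e j)
     (fun a => nu 0 0 a * 'D_(e j) (X a) y).
    move=> a _; have := is_deriveMf (is_derive_cst (nu 0 0 a) y (e j)) (sm_is_derive (e j) (smooth_sm smF a) I).
    by rewrite mul0r add0r.
  have -> : \sum_a nu 0 0 a * 'D_(e j) (X a) y = dot (nu 0) (dF F j y).
    by apply: eq_bigr => a _; rewrite dF_coord.
  by have /(nu_dot0 _ By) -> := (nuF By).2 j; rewrite mulr0.
have Gc x' : cball x' -> G x' = G 0.
  move=> Bx; have [|t /andP[t0 t1]] := @MVT_line_gt0 R _ G 0 x' 1 ltr01.
    by move=> t _; exact: sm_derivable smG I.
  rewrite add0r scale1r mul1r add0r => /eqP; rewrite subr_eq => /eqP ->.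
  by rewrite DG ?add0r //; apply: cball_scale => //; rewrite !ltW.
move=> Bx; rewrite -[LHS]/(G x) Gc // -(Gc pole); last exact/usphere_cball/usphere_pole.
have pB := usphere_cball usphere_pole.
exact: ((nu_dot0 (F pole) pB).1 (freeF usphere_pole)).
Qed.

Lemma sm_dist (w : 'rV[R]_n.+1) : sm setT (fun x => dot (F x - w) (F x - w)).
Proof.
have oT := @openT 'rV[R]_n.
apply: (sm_sum oT) => a _.
have smd : sm setT (fun x => (F x - w) 0 a).
  apply: (sm_ext oT (f := fun x => X a x - w 0 a)); first by move=> y _; rewrite !mxE.
  by apply: (sm_sub_fun oT (smooth_sm smF a)); exact: sm_cst.
exact: (sm_mul oT smd smd).
Qed.

Lemma derive_dist (w : 'rV[R]_n.+1) x v :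
  'D_v (fun x => dot (F x - w) (F x - w)) x =
  2 * dot v ((F x - w) *m (Pilot.Defs.jacobian F x)^T).
Proof.
have oT := @openT 'rV[R]_n.
rewrite (sm_deriveE _ oT (sm_dist w) I) mulr_sumr; apply: eq_bigr => j _.
have [|_ ->] := @is_deriveSf R _ _ (index_enum _) xpredT (fun a y => (F y - w) 0 a * (F y - w) 0 a) x (e j)
     (fun a => 2 * ((F x - w) 0 a * 'D_(e j) (X a) x)).
  move=> a _.
  have D : is_derive x (e j) (fun y => (F y - w) 0 a) ('D_(e j) (X a) x).
    have := is_deriveBf (sm_is_derive (e j) (smooth_sm smF a) I) (is_derive_cst (w 0 a) x (e j)).
    rewrite subr0 (_ : (fun y => X a y - w 0 a) = (fun y => (F y - w) 0 a)) //.
    by apply/funext => y; rewrite !mxE.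
  have -> : 2 * ((F x - w) 0 a * 'D_(e j) (X a) x) =
    'D_(e j) (X a) x * (F x - w) 0 a + (F x - w) 0 a * 'D_(e j) (X a) x by ring.
  exact: (is_deriveMf D D).
rewrite -mulr_sumr mulrCA; congr (2 * (_ * _)); rewrite mxE; apply: eq_bigr => a _.
by rewrite [_^T _ _]mxE jacobianE.
Qed.

(* At a point x where |F x - w| is minimal, F x - w is normal to the tangent space
   if x is interior, and a nonpositive multiple of F x if x is on the sphere. *)
Lemma flat_surj (w : 'rV[R]_n.+1) : dot w w <= 1 -> dot (nu 0) w = 0 ->
  exists2 x, cball x & F x = w.
Proof.
move=> w1 nw; pose m x := dot (F x - w) (F x - w).
have oT := @openT 'rV[R]_n.
have cm : {within @cball R n, continuous m}.
  by apply: continuous_subspaceT => x; exact: (sm_cont (sm_dist w) I).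
have [|x] := compact_EVT_min _ (@cball_compact R n) cm; first by exists 0; exact: cball0.
rewrite inE => Bx mx; have {}mx y : cball y -> m x <= m y by move=> By; apply: mx; rewrite inE.
exists x => //; have [nu1 nuJ] := nuF Bx.
have gu : Pilot.Defs.jacobian F x *m (Pilot.Defs.jacobian F x)^T \in unitmx.
  by apply: gram_unitmx; exact: immF.
have nJ := nu_jacobian nuF Bx.
have tangent0 (z : 'rV[R]_n.+1) : z *m (Pilot.Defs.jacobian F x)^T = 0 -> dot (nu 0) z = 0 -> z = 0.
  move=> zJ /(nu_dot0 z Bx) nz; rewrite (normal_line gu nu1 nJ zJ) dotC nz scale0r //.
have n0y : dot (nu 0) (F x - w) = 0.
  by rewrite -scaleN1r dotDr dotZr nw flat_height // mulr0 addr0.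
apply/eqP; rewrite -subr_eq0; apply/eqP.
have [xs|xs] := eqVneq (dot x x) 1; last first.
  have xlt : dot x x < 1 by rewrite lt_neqAle xs.
  apply: tangent0 => //; set z := _ *m _.
  have D0 v : dot v z = 0.
    have : 'D_v (fun y => - m y) x = 0.
      apply: derive_max_eq0; first by apply: (derivableN (f := m)); exact: sm_derivable (sm_dist w) I.
      apply: filterS (open_nbhs_nbhs (conj (@oball_open R n) xlt)) => y /oball_cball By.
      by rewrite lerN2 mx.
    rewrite (_ : (fun y => - m y) = - m) // deriveN; last exact: sm_derivable (sm_dist w) I.
    by rewrite derive_dist => /eqP; rewrite oppr_eq0 mulf_eq0 pnatr_eq0 /= => /eqP.
  by apply/eqP; rewrite -dot_eq0 D0.
have Dneg v : dot v x < 0 -> 0 <= dot v ((F x - w) *m (Pilot.Defs.jacobian F x)^T).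
  move=> vx; rewrite -(pmulr_rge0 _ (ltr0Sn R 1)) -derive_dist -oppr_le0 -deriveN; last exact: sm_derivable (sm_dist w) I.
  apply: (derive_ball_le0 oT (sm_opp oT (sm_dist w)) I xs vx) => y _ By.
  by rewrite lerN2 mx.
(* |F|^2 is maximal at x too, so the radial direction in the domain is also expressed through F
   x. *)
have qneg v : dot v x < 0 -> 0 <= dot v (- (F x *m (Pilot.Defs.jacobian F x)^T)).
  move=> vx; rewrite -scaleN1r dotZr mulN1r oppr_ge0 -(pmulr_rle0 _ (ltr0Sn R 1)).
  have := derive_dist 0 x v; rewrite subr0 => <-.
  apply: (derive_ball_le0 oT (sm_dist 0) I xs vx) => y _ By.
  by rewrite !subr0 (sphF xs) q_le1.
have [zE zc] := inward_cone xs Dneg.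
have [fE fc] := inward_cone xs qneg.
set c := dot _ x in zE zc; set l := dot _ x in fE fc.
have fE' : F x *m (Pilot.Defs.jacobian F x)^T = (- l) *: x by rewrite scaleNr -fE opprK.
have nFx := flat_height Bx.
have l0 : l != 0.
  apply/eqP => l0; have F0 : F x = 0 by apply: tangent0 => //; rewrite fE' l0 oppr0 scale0r.
  have := sphF xs; rewrite F0 /dot big1 => [/esym/eqP|k _]; first by rewrite oner_eq0.
  by rewrite mxE mul0r.
(* Both cone coefficients are nonpositive, so k >= 0; then w = (1 + k) F x with |w| <= 1 = |F x|
   forces k = 0. *)
pose k := c / l.
have Fk : F x - w = (- k) *: F x.
  apply/eqP; rewrite -subr_eq0 -scaleNr opprK; apply/eqP; apply: tangent0.
    rewrite mulmxDl zE -scalemxAl fE' scalerA -scalerDl /k mulrN divfK // subrr scale0r //.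
  by rewrite dotDr dotZr n0y nFx mulr0 addr0.
have k0 : 0 <= k by rewrite /k -mulrNN -invrN mulr_ge0 ?invr_ge0 ?oppr_ge0.
have wE : w = (1 + k) *: F x.
  by rewrite scalerDl scale1r -[k *: _]opprK -scaleNr -Fk opprB addrC subrK.
move: w1; rewrite wE dotZl dotZr (sphF xs) mulr1 => w1.
have k00 : k = 0.
  by apply/eqP; rewrite eq_le k0 andbT; nra.
by rewrite k00 addr0 scale1r subrr.
Qed.
End Flat.
End FreeBoundary.

Unset Implicit Arguments.

Theorem theorem1p4 (R : realType) (n : nat) (hn : (0 < n)%N)
  (F : 'rV[R]_n -> 'rV[R]_n.+1) (nu : 'rV[R]_n -> 'rV[R]_n.+1) :
  smooth F ->
  immersion_on F (@cball R n) ->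
  unit_normal_on F nu (@cball R n) ->
  (* minimal *)
  (forall x, @cball R n x -> mean_curv F nu x = 0) ->
  (* free boundary on the unit sphere *)
  F @` @usphere R n = F @` @cball R n `&` @usphere R n.+1 ->
  (forall x, @usphere R n x -> dot (nu x) (F x) = 0) ->
  (* not a standard (equatorial) flat disk *)
  ~ (exists a : 'rV[R]_n.+1, a != 0 /\
       F @` @cball R n = [set p | dot p p <= 1 /\ dot a p = 0]) ->
  (sup [set normA2 F nu x | x in @cball R n]) ^+ 2
    > n%:R * inf [set normA2 F nu x | x in @usphere R n].
Proof.
move=> smF immF [_ nuF] minF bdF freeF notflat.
have sphF x : usphere x -> dot (F x) (F x) = 1.
  move=> xs; have : (F @` @usphere R n) (F x) by exists x.
  by rewrite bdF => -[].
have s_ge0 := s_ge0 smF immF nuF minF.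
set S := sup _; set c := inf _.
have [xM BM xmax] := test_max smF immF nuF minF 1 0 0.
have tE y : test F nu 1 0 0 y = normA2 F nu y by rewrite /test !mul0r mul1r !addr0.
have sS x : cball x -> normA2 F nu x <= S.
  (* [sup] dominates the values once they are known to be bounded above; the maximum at [xM] is such
     a bound. *)
  move=> Bx; apply: ub_le_sup; last by exists x.
  by exists (normA2 F nu xM) => _ [y By <-]; rewrite -!tE; exact: xmax.
have cs x : usphere x -> c <= normA2 F nu x.
  move=> xs; apply: ge_inf; last by exists x.
  by exists 0 => _ [y ys <-]; apply/s_ge0/usphere_cball.
(* If S <= 0 then |A|^2, which lies between 0 and S, vanishes on the ball, and the image is the flat
   disk with normal [nu 0]. *)
have [S0|S0] := ltrP 0 S.
  exact: (inf_lt_sqr_sup hn smF immF nuF minF sphF freeF sS cs S0).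
exfalso; apply: notflat; exists (nu 0).
have s0 x : cball x -> normA2 F nu x = 0.
  by move=> Bx; apply/eqP; rewrite eq_le s_ge0 // (le_trans (sS x Bx)).
have B0 := @cball0 R n.
split.
  apply/eqP => nu0; have [] := nuF 0 B0; rewrite nu0 /dot big1 => [/esym/eqP|k _].
    by rewrite oner_eq0.
  by rewrite mxE mul0r.
apply/seteqP; split => [_ [x Bx <-]|p [p1 np]].
  split; first exact: (q_le1 hn smF immF nuF minF sphF).
  exact: (flat_height hn smF immF nuF minF freeF s0).
have [x Bx <-] := flat_surj hn smF immF nuF minF sphF freeF s0 p1 np.
by exists x.
Qed.
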